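(* Every fat flow optimal weight function for a dumbbell is virtually bar uniform. That is, if $D$ is a dumbbell with bar height $n$ and $\rho$ is a fat flow optimal weight function for $D$, then $\rho(t)=\frac1n H_\rho$ for every tile $t$ in the bar of $D$ whose skinny path distance to the balls of $D$ is at least $3n$.
   Context: **Quadrilaterals.** A (conformal) quadrilateral is a planar disk $D$ with four distinguished boundary points $a,b,c,d$ that appear in clockwise order on the boundary. These four points determine a top edge $ab$, a right edge $bc$, a bottom edge $cd$, and a left edge $da$. **Dumbbells.** A dumbbell $D$ is a conformal quadrilateral which is a subcomplex of the square tiling of the plane (the tiling by squares of equal size). It consists of a left ball, a right ball, and a bar, all of which are subcomplexes of $D$. The bar is a rectangle at least six times as wide as high. It meets the left ball in a connected subcomplex of the left side of the bar, and it meets the right ball in a connected subcomplex of the right side of the bar. The bar is never empty, but the balls are allowed to be empty. The bar height of $D$ is the number of squares in each column of squares of the bar. The tiles of $D$ are the squares of the tiling contained in $D$. **Weight functions.** A weight function for $D$ is a nonnegative real-valued function $\rho$, not identically zero, on the set of tiles of $D$. The $\rho$-length of a path in $D$ is the sum of the weights $\rho(t)$ of the tiles $t$ that the image of the path intersects. The $\rho$-height $H_\rho$ is the minimum $\rho$-length of a path in $D$ that joins the top edge and the bottom edge of $D$. The $\rho$-area $A_\rho$ is the sum of $\rho(t)^2$ over all tiles $t$ of $D$. The fat flow modulus of $D$ with respect to $\rho$ is $H_\rho^2/A_\rho$. A weight function is fat flow optimal if its fat flow modulus is the supremum of the fat flow moduli of all weight functions for $D$; such a weight function exists and is unique up to scaling.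 **Skinny path distance.** The skinny path distance between two subsets of $D$ is one less than the minimum length (number of tiles) of a chain of tiles which joins a point in one subset to a point in the other subset, where a chain of tiles is a finite sequence of tiles of $D$ in which consecutive tiles intersect.
   Formalization: The dumbbell's corners are placed so that the bar's top side lies in the top edge and its bottom side in the bottom edge; where a ball is empty, the left (right) edge is the bar's left (right) side. With arbitrary corners the claim fails. *)

(* Defs.v *)
From HB Require Import structures.
From mathcomp Require Import all_boot all_order all_algebra.
From mathcomp Require Import all_classical all_reals all_analysis.

Set Implicit Arguments.
Unset Strict Implicit.
Unset Printing Implicit Defensive.

Import Order.TTheory GRing.Theory Num.Theory.
Import numFieldNormedType.Exports.
Local Open Scope classical_set_scope.
Local Open Scope ring_scope.

(* The plane is [R * R], with the first axis pointing right and the second one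
   pointing up. *)

Section Plane.
Context {R : realType}.
Implicit Types (A B D : set (R * R)) (g : R -> R * R) (p : R * R).

Definition homeomorphic A B : Prop :=
  exists f h : R * R -> R * R,
    [/\ {within A, continuous f}, {within B, continuous h},
        set_fun A B f, set_fun B A h
      & {in A, cancel f h} /\ {in B, cancel h f}].

Definition planar_disk D : Prop :=
  homeomorphic [set p : R * R | p.1 ^+ 2 + p.2 ^+ 2 <= 1] D.

Definition frontier D : set (R * R) := closure D `\` interior D.

(* Winding number -1: in polar coordinates around [p], a continuous
   determination [theta] of the angle decreases by [2 * pi] along [g]. *)
Definition winds_once_clockwise g p : Prop :=
  exists r theta : R -> R,
    [/\ {within `[0, 1], continuous theta},
        forall s, s \in `[0, 1] ->
          0 < r s /\ g s = (p.1 + r s * cos (theta s),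
                            p.2 + r s * sin (theta s))
      & theta 1 - theta 0 = - (2 * pi)].

Definition clockwise_boundary_loop D g : Prop :=
  [/\ {within `[0, 1], continuous g},
      g 0 = g 1,
      {in `[0, 1[ &, injective g},
      g @` `[0, 1] = frontier D
    & forall p, interior D p -> winds_once_clockwise g p].

(* The four distinguished points are [qloop 0], [qloop qb], [qloop qc] and
   [qloop qd]: the boundary is parametrized clockwise, starting from the first
   of them. *)
Record quadrilateral := Quadrilateral {
  qdisk :> set (R * R) ;
  qloop : R -> R * R ;
  qb : R ;
  qc : R ;
  qd : R ;
  qdisk_disk : planar_disk qdisk ;
  qloop_clockwise : clockwise_boundary_loop qdisk qloop ;
  qb_gt0 : 0 < qb ;
  qb_lt_qc : qb < qc ;
  qc_lt_qd : qc < qd ;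
  qd_lt1 : qd < 1
}.

Definition top_edge (Q : quadrilateral) := qloop Q @` `[0, qb Q].
Definition right_edge (Q : quadrilateral) := qloop Q @` `[qb Q, qc Q].
Definition bottom_edge (Q : quadrilateral) := qloop Q @` `[qc Q, qd Q].
Definition left_edge (Q : quadrilateral) := qloop Q @` `[qd Q, 1].

(* The rectangle with lower left corner [(x, y)], width [w] and height [h];
   either dimension may be zero. *)
Definition rect (x y : int) (w h : nat) : set (R * R) :=
  [set p | x%:~R <= p.1 <= (x + w%:Z)%:~R /\
           y%:~R <= p.2 <= (y + h%:Z)%:~R].

(* The closed cells of the tiling by unit squares are the rectangles with
   dimensions at most 1: vertices, edges and squares. *)
Definition subcomplex (X : set (R * R)) : Prop :=
  exists C : set (int * int * (bool * bool)),
    X = \bigcup_(c in C) rect c.1.1 c.1.2 c.2.1 c.2.2.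

End Plane.

Arguments quadrilateral R : clear implicits.

(* A square of the tiling is named by its lower left corner. *)
Definition tile : Type := (int * int)%type.

Definition square {R : realType} (t : tile) : set (R * R) :=
  rect t.1 t.2 1 1.

Definition tiles {R : realType} (D : set (R * R)) : set tile :=
  [set t | square t `<=` D].

(* [bar_width] and [bar_height] are counted in tiles. The bar is placed so that
   its top and bottom sides lie in the top and bottom edges of the
   quadrilateral; at an end with an empty ball, the left (right) edge of the
   quadrilateral is the left (right) side of the bar. *)
Record dumbbell (R : realType) := Dumbbell {
  dquad :> quadrilateral R ;
  left_ball : set (R * R) ;
  right_ball : set (R * R) ;
  bar_x : int ;
  bar_y : int ;
  bar_width : nat ;
  bar_height : nat ;
  bar := rect bar_x bar_y bar_width bar_height : set (R * R) ;
  bar_left := rect bar_x bar_y 0 bar_height : set (R * R) ;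
  bar_right :=
    rect (bar_x + bar_width%:Z) bar_y 0 bar_height : set (R * R) ;
  bar_bottom := rect bar_x bar_y bar_width 0 : set (R * R) ;
  bar_top :=
    rect bar_x (bar_y + bar_height%:Z) bar_width 0 : set (R * R) ;
  dumbbell_subcomplex : subcomplex dquad ;
  left_ball_subcomplex : subcomplex left_ball ;
  right_ball_subcomplex : subcomplex right_ball ;
  dumbbellE : qdisk dquad = left_ball `|` bar `|` right_ball ;
  bar_height_gt0 : (0 < bar_height)%N ;
  bar_elongated : (6 * bar_height <= bar_width)%N ;
  left_ball_bar : left_ball `&` bar `<=` bar_left ;
  left_ball_bar_connected : connected (left_ball `&` bar) ;
  left_ball_bar_neq0 : left_ball !=set0 -> (left_ball `&` bar) !=set0 ;
  right_ball_bar : right_ball `&` bar `<=` bar_right ;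
  right_ball_bar_connected : connected (right_ball `&` bar) ;
  right_ball_bar_neq0 : right_ball !=set0 -> (right_ball `&` bar) !=set0 ;
  bar_top_edge : bar_top `<=` top_edge dquad ;
  bar_bottom_edge : bar_bottom `<=` bottom_edge dquad ;
  left_ball_empty : left_ball = set0 -> left_edge dquad = bar_left ;
  right_ball_empty : right_ball = set0 -> right_edge dquad = bar_right
}.

Section FatFlow.
Context {R : realType} (D : dumbbell R).
Implicit Types (rho : tile -> R) (g : R -> R * R).

(* Only the values of [rho] on the tiles of [D] matter. *)
Definition is_weight rho : Prop :=
  (forall t, tiles D t -> 0 <= rho t) /\ (exists2 t, tiles D t & rho t != 0).

Definition joins_top_bottom g : Prop :=
  [/\ {within `[0, 1], continuous g}, g @` `[0, 1] `<=` D,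
      top_edge D (g 0) & bottom_edge D (g 1)].

(* The set of tiles of [D] is finite because [D] is compact, so that this and
   the next sum are the usual ones. *)
Definition rho_length rho g : R :=
  \sum_(t \in [set t | tiles D t /\ square t `&` g @` `[0, 1] !=set0]) rho t.

Definition rho_area rho : R := \sum_(t \in tiles D) rho t ^+ 2.

(* There are finitely many lengths, so the infimum is a minimum. *)
Definition rho_height rho : R :=
  inf [set rho_length rho g | g in joins_top_bottom].

Definition fat_flow_modulus rho : R := rho_height rho ^+ 2 / rho_area rho.

Definition fat_flow_optimal rho : Prop :=
  is_weight rho /\
  fat_flow_modulus rho = sup [set fat_flow_modulus sigma | sigma in is_weight].

(* A chain is written [t :: c], so its length minus one is [size c]. *)
Definition is_chain (t : tile) (c : seq tile) : Prop :=
  (forall u, u \in t :: c -> tiles D u) /\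
  (forall i, (i < size c)%N ->
     (square (nth t (t :: c) i) : set (R * R)) `&`
       square (nth t (t :: c) i.+1) !=set0).

Definition chain_joins (X Y : set (R * R)) (t : tile) (c : seq tile) : Prop :=
  [/\ is_chain t c, square t `&` X !=set0 & square (last t c) `&` Y !=set0].

(* Equal to [+oo] when no chain joins [X] to [Y], e.g. when [Y] is empty. *)
Definition skinny_path_distance (X Y : set (R * R)) : \bar R :=
  ereal_inf [set ((size tc.2)%:R)%:E | tc in
               [set tc : tile * seq tile | chain_joins X Y tc.1 tc.2]].

End FatFlow.

(* Main.v *)
Require Import Defs.
From mathcomp Require Import all_boot all_order all_algebra.
From mathcomp Require Import all_classical all_reals all_analysis.
From mathcomp Require Import zify ring lra.

(* Let H be the rho-height and n the bar height. For a tile t let b(t) be the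
   least rho-length of a path from t to the bottom edge and a(t) = b(t) - rho t;
   the intervals (a(t), b(t)] of tiles sharing an edge meet or abut, and along
   every path from top to bottom they cover (0, H].

   Fix a tile t0 of the bar far from the balls. In the column of the bar at
   distance s from t0, bound the levels above by the linear profile (from 0 to
   H) moved down by s rows and cut off at H, and below by the profile moved up
   by s rows and cut off at 0. Profiles of neighbouring columns differ by at
   most one row, so clamping the intervals between these barriers preserves the
   covering property, and the lengths of the clamped intervals form an
   admissible weight; for s >= n the barriers are trivial, so nothing has to be
   compatible with the balls. The upper barrier is concave and the lower one
   convex, so each is the cheapest profile on its side of itself; since the
   energy of a column is submodular, clamping does not increase the area. By
   strict convexity the optimal weight coincides with the clamped one, which is
   H / n in the column of t0. *)

Set Implicit Arguments.
Unset Strict Implicit.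
Unset Printing Implicit Defensive.

Import Order.TTheory GRing.Theory Num.Theory.
Import numFieldNormedType.Exports.
Local Open Scope classical_set_scope.
Local Open Scope ring_scope.

(** * Interval coverings and energies of columns *)

(** Induction on the number of intervals: remove one that contains the right end [v]. It misses
    every point up to its own lower end [a t], so the others must cover everything from [u] to
    [a t]. *)
Lemma interval_cover (R : realFieldType) (T : eqType) (s : seq T)
    (a b : T -> R) (u v : R) :
    {in s, forall t, a t <= b t} ->
    (forall c, u < c <= v -> exists2 t, t \in s & a t < c <= b t) ->
  v - u <= \sum_(t <- s) (b t - a t).
Proof.
have [m] := ubnP (size s); elim: m s v => // m IHm s v /ltnSE ssm ab cov.
have sum_ge0 : 0 <= \sum_(t <- s) (b t - a t).
  by rewrite big_seq; apply: sumr_ge0 => t /ab; rewrite subr_ge0.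
have [vu|uv] := leP v u; first by apply: le_trans sum_ge0; rewrite subr_le0.
have [|t ts /andP[atv vbt]] := cov v; first by rewrite uv lexx.
have ps := perm_to_rem ts.
rewrite (perm_big _ ps) big_cons.
have : a t - u <= \sum_(t' <- rem t s) (b t' - a t').
  apply: IHm.
  - have := perm_size ps; rewrite /= => e; lia.
  - by move=> t' /mem_rem/ab.
  - move=> c /andP[uc cat]; have [|t' t's /andP[h1 h2]] := cov c.
      by rewrite uc (le_trans cat (ltW atv)).
    exists t'; last by rewrite h1.
    move: t's; rewrite (perm_mem ps) inE => /orP[/eqP tt'|//].
    by move: h1; rewrite tt' ltNge cat.
by move: (\sum_(_ <- _) _) => S /=; move: vbt; lra.
Qed.

(** Submodularity of the squared length. If neither interval is nested in the other, the two sides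
    agree; if one is, the new lengths have the same sum and are no farther apart. *)
Lemma meet_join_energy (R : realFieldType) (a b A B : R) : a <= b -> A <= B ->
  (Num.min b B - Num.min a A) ^+ 2 + (Num.max b B - Num.max a A) ^+ 2 <=
  (b - a) ^+ 2 + (B - A) ^+ 2.
Proof. by case: (leP a A); case: (leP b B) => *; nra. Qed.

(** Abel summation. It is used with [s] the slopes of a concave profile and [y] the excess of
    another profile over it. *)
Lemma sum_slope_ge (R : realFieldType) n (s y : nat -> R) :
    y 0 = 0 -> (forall j, 0 <= y j) ->
    (forall j, (j.+1 < n)%N -> s j.+1 <= s j) ->
    (forall j, (j < n)%N -> 0 <= s j) ->
  0 <= \sum_(j < n) s j * (y j.+1 - y j).
Proof.
case: n => [|n] y0 yge0 sdec s_ge0; first by rewrite big_ord0.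
(* The induction carries the boundary term of the summation by parts, which is nonnegative at the
   end. *)
suff H m : (m <= n)%N -> s m * y m.+1 <= \sum_(j < m.+1) s j * (y j.+1 - y j).
  by apply: le_trans (H n (leqnn n)); rewrite mulr_ge0 // s_ge0.
elim: m => [|m IHm] mn; first by rewrite big_ord_recr big_ord0 /= y0; lra.
rewrite big_ord_recr /=; have := IHm (ltnW mn).
have := sdec m mn; have := yge0 m.+1; nra.
Qed.

(* Summation by parts shows that no profile above the concave profile [B] has
   less energy than [B]; [meet_join_energy] turns this into a bound on the part
   below [B]. *)
Lemma energy_meet_concave (R : realFieldType) n (a b B : nat -> R) :
    a 0 <= B 0 -> (forall j, (j < n)%N -> a j <= b j) ->
    (forall j, (j.+1 < n)%N -> a j.+1 <= b j) ->
    (forall j, (j < n)%N -> B j <= B j.+1) ->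
    (forall j, (j.+1 < n)%N -> B j.+2 - B j.+1 <= B j.+1 - B j) ->
  \sum_(j < n) (Num.min (b j) (B j.+1) - Num.min (a j) (B j)) ^+ 2 <=
  \sum_(j < n) (b j - a j) ^+ 2.
Proof.
move=> a0 ab chain Bmono Bconc.
(* The excess over [B] at the horizontal edge [j]; it is 0 at the bottom edge because [a 0] does not
   exceed [B 0]. *)
pose y j := if j is i.+1 then Num.max (b i) (B i.+1) - B i.+1 else 0.
have y_ge0 j : 0 <= y j.
  by case: j => [|j] //=; rewrite subr_ge0 le_max lexx orbT.
have slope := @sum_slope_ge R n (fun j => B j.+1 - B j) y erefl y_ge0 Bconc.
have {}slope := slope (fun j jn => etrans (subr_ge0 _ _) (Bmono j jn)).
have join_ge : \sum_(j < n) (B j.+1 - B j) ^+ 2 <=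
    \sum_(j < n) (Num.max (b j) (B j.+1) - Num.max (a j) (B j)) ^+ 2.
  rewrite -subr_ge0 -sumrB; apply: le_trans (_ : 0 <= _ *+ 2) _.
    exact: mulrn_wge0 slope.
  rewrite -sumrMnl; apply: ler_sum => -[j jn] _; rewrite [nat_of_ord _]/=.
  set x := Num.max (b j) (B j.+1) - Num.max (a j) (B j).
  have : B j.+1 - B j + (y j.+1 - y j) <= x.
    have -> : y j.+1 = Num.max (b j) (B j.+1) - B j.+1 by [].
    have h : Num.max (a j) (B j) <= y j + B j.
      case: j jn {x} => [|j] jn; first by rewrite /y add0r ge_max a0 lexx.
      by rewrite /y subrK ge_max !le_max chain //= lexx orbT.
    by move: h; rewrite /x; lra.
  have : 0 <= B j.+1 - B j by rewrite subr_ge0 Bmono.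
  (* From [x ^+ 2 - d ^+ 2 = (x - d) ^+ 2 + 2 * d * (x - d)] and [x - d >= e], the gain is at least
     [2 * d * e]. *)
  move: x (B j.+1 - B j) (y j.+1 - y j) => x d e d_ge0 h.
  have h' : 0 <= x - (d + e) by rewrite subr_ge0.
  have := mulr_ge0 d_ge0 h'; have := sqr_ge0 (x - d).
  by rewrite mulr2n; lra.
have := @ler_sum R _ (index_enum 'I_n) xpredT _ _
  (fun j _ => meet_join_energy (ab j (ltn_ord j)) (Bmono j (ltn_ord j))).
rewrite !big_split /=; lra.
Qed.

(** Turning the column upside down and negating all levels makes [C] concave, exchanges the roles of
    [a] and [b], and reduces the claim to [energy_meet_concave]. *)
Lemma energy_join_convex (R : realFieldType) n (a b C : nat -> R) :
    C n <= b n.-1 -> (forall j, (j < n)%N -> a j <= b j) ->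
    (forall j, (j.+1 < n)%N -> a j.+1 <= b j) ->
    (forall j, (j < n)%N -> C j <= C j.+1) ->
    (forall j, (j.+1 < n)%N -> C j.+1 - C j <= C j.+2 - C j.+1) ->
  \sum_(j < n) (Num.max (b j) (C j.+1) - Num.max (a j) (C j)) ^+ 2 <=
  \sum_(j < n) (b j - a j) ^+ 2.
Proof.
case: n => [|n] bn ab chain Cmono Cconv; first by rewrite !big_ord0.
have := @energy_meet_concave R n.+1 (fun j => - b (n - j)%N)
  (fun j => - a (n - j)%N) (fun j => - C (n.+1 - j)%N).
rewrite (reindex_inj rev_ord_inj) /=.
rewrite [X in _ -> _ -> _ -> _ -> _ -> _ <= X](reindex_inj rev_ord_inj) /=.
have E (j : 'I_n.+1) : (n - (n.+1 - j.+1))%N = j by have := ltn_ord j; lia.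
under eq_bigr => j _.
  rewrite E (_ : (n.+1 - (n.+1 - j.+1).+1)%N = j); last by have := ltn_ord j; lia.
  rewrite (_ : (n.+1 - (n.+1 - j.+1))%N = j.+1); last by have := ltn_ord j; lia.
  rewrite -!oppr_max opprK addrC.
  over.
under [X in _ -> _ -> _ -> _ -> _ -> _ <= X]eq_bigr => j _.
  rewrite E opprK addrC.
  over.
apply.
- by rewrite !subn0 lerN2.
- by move=> j jn; rewrite lerN2 ab //; lia.
- move=> j jn; rewrite lerN2 (_ : (n - j)%N = (n - j.+1).+1); last by lia.
  by apply: chain; lia.
- move=> j jn; rewrite lerN2 (_ : (n.+1 - j)%N = (n.+1 - j.+1).+1); last by lia.
  by apply: Cmono; lia.
- move=> j jn; have := Cconv (n.+1 - j.+2)%N.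
  rewrite (_ : (n.+1 - j)%N = (n.+1 - j.+2).+2); last by lia.
  rewrite (_ : (n.+1 - j.+1)%N = (n.+1 - j.+2).+1); last by lia.
  move=> /(_ ltac:(lia)); lra.
Qed.

Lemma le_min_max (R : realDomainType) (a b x y z v : R) :
  a <= b -> x <= y -> z <= v ->
  Num.max (Num.min a x) z <= Num.max (Num.min b y) v.
Proof.
move=> ab xy zv; rewrite ge_max !le_max zv orbT andbT le_min !ge_min ab xy.
by rewrite orbT.
Qed.

(** * Tiles of a planar disk *)

Section Continuity.
Context {R : realType}.
Implicit Types V W X : normedModType R.

Lemma within_continuousP V W (A : set V) (f : V -> W) :
  {within A, continuous f} <->
  forall x, A x -> forall e, 0 < e -> exists2 d, 0 < d &
    forall z, A z -> `|x - z| < d -> `|f x - f z| < e.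
Proof.
rewrite subspace_continuousP; split=> cf x Ax.
  move=> e e0; have /cvgrPdist_lt/(_ e e0)/nbhs_normP[d /= d0 xd] := cf x Ax.
  by exists d => // z Az xz; apply: xd.
apply/cvgrPdist_lt => e /(cf x Ax)[d d0 xd].
by apply/nbhs_normP; exists d => //= z xz Az; exact: xd.
Qed.

Lemma within_continuous_within V W X (A : set V) (B : set W)
    (f : V -> W) (g : W -> X) :
    (forall x, A x -> B (f x)) ->
  {within A, continuous f} -> {within B, continuous g} ->
  {within A, continuous (g \o f)}.
Proof.
move=> AB /within_continuousP cf /within_continuousP cg.
apply/within_continuousP => x Ax e e0.
have [d d0 gd] := cg _ (AB x Ax) e e0.
have [d' d'0 fd] := cf x Ax d d0.
by exists d' => // z Az xz; apply: gd; [exact: AB | exact: fd].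
Qed.

Lemma norm_fst_le (p : R * R) : `|p.1| <= `|p|.
Proof. by rewrite prod_normE le_max lexx. Qed.

Lemma norm_snd_le (p : R * R) : `|p.2| <= `|p|.
Proof. by rewrite prod_normE le_max lexx orbT. Qed.

Lemma continuous_fst : continuous (fst : R * R -> R).
Proof. by move=> p; exact: cvg_fst. Qed.

Lemma continuous_snd : continuous (snd : R * R -> R).
Proof. by move=> p; exact: cvg_snd. Qed.

End Continuity.

Section Tiling.
Context {R : realType}.
Implicit Types (p q r : R * R) (t u : tile) (D X : set (R * R)).

Lemma compact_unit_disk : compact [set p : R * R | p.1 ^+ 2 + p.2 ^+ 2 <= 1].
Proof.
apply: (subclosed_compact _
  (compact_setX (@segment_compact R (-1) 1) (@segment_compact R (-1) 1))).
  apply: (@preimage_closed _ _ (fun p : R * R => p.1 ^+ 2 + p.2 ^+ 2)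
    [set x | x <= 1]); last exact: closed_le.
  move=> p _; apply: cvgD; apply: (@cvg_comp _ _ _ _ (fun x => x ^+ 2)).
  - exact: continuous_fst.
  - exact: exprn_continuous.
  - exact: continuous_snd.
  - exact: exprn_continuous.
by move=> [x y] /= h; rewrite !in_itv /=; split; apply/andP; split; nra.
Qed.

Lemma planar_disk_compact D : planar_disk D -> compact D.
Proof.
move=> [f [h [cf ch fD hD [fK hK]]]].
suff -> : D = f @` [set p : R * R | p.1 ^+ 2 + p.2 ^+ 2 <= 1].
  exact: continuous_compact cf compact_unit_disk.
apply/seteqP; split=> [p Dp|_ [x xD <-]]; last exact: fD.
by exists (h p); [exact: hD | rewrite hK ?inE].
Qed.

Lemma planar_disk_closed D : planar_disk D -> closed D.
Proof.
by move=> /planar_disk_compact; apply: compact_closed; exact: norm_hausdorff.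
Qed.

Lemma in_square t p : square t p <->
  t.1%:~R <= p.1 <= t.1%:~R + 1 /\ t.2%:~R <= p.2 <= t.2%:~R + 1.
Proof. by rewrite /square /rect /= !intrD. Qed.

Lemma rect_closed (x y : int) (w h : nat) :
  closed (rect x y w h : set (R * R)).
Proof.
rewrite (_ : rect _ _ _ _ =
  fst @^-1` [set` `[x%:~R : R, (x + w%:Z)%:~R]] `&`
  snd @^-1` [set` `[y%:~R : R, (y + h%:Z)%:~R]]); last first.
  by apply/seteqP; split=> p /=; rewrite !in_itv.
apply: closedI; apply: preimage_closed; try exact: interval_closed.
  by move=> p _; exact: continuous_fst.
by move=> p _; exact: continuous_snd.
Qed.

Lemma square_closed t : closed (square t : set (R * R)).
Proof. exact: rect_closed. Qed.

Lemma tiles_finite D : planar_disk D -> finite_set (tiles D).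
Proof.
move=> /planar_disk_compact/compact_bounded[M [_ DM]].
have {}DM p : D p -> `|p| <= `|M| + 1.
  by move=> Dp; apply: DM Dp; rewrite (le_lt_trans (ler_norm M)) // ltrDl.
have [N MN] : exists N : nat, `|M| + 1 < N%:R.
  exists (Num.bound (`|M| + 1)); apply: archi_boundP.
  by rewrite addr_ge0.
pose s := [seq k%:Z - N%:Z | k <- iota 0 (N + N).+1].
apply: (@sub_finite_set _ _ ([set` s] `*` [set` s])).
  move=> [x y] /= tD.
  have /DM := tD (x%:~R, y%:~R) ltac:(apply/in_square => /=; lra).
  have ins z : `|z%:~R : R| < N%:R -> z \in s.
    rewrite -intr_norm -[N%:R]/(N%:~R) ltr_int => zN.
    apply/mapP; exists (absz (z + N%:Z)); last by lia.
    by rewrite mem_iota; lia.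
  move=> xyM; split; apply: ins.
    by apply: le_lt_trans MN; apply: le_trans xyM; exact: (norm_fst_le (_, _)).
  by apply: le_lt_trans MN; apply: le_trans xyM; exact: (norm_snd_le (_, _)).
by apply: finite_setX; exact: finite_seq.
Qed.

Lemma squares_closed (A : set tile) : finite_set A ->
  closed (\bigcup_(t in A) (square t : set (R * R))).
Proof. by move=> fA; apply: closed_bigcup => // t _; exact: square_closed. Qed.

End Tiling.

(** * Paths and tiles *)

Section Paths.
Context {R : realType}.
Implicit Types (p q r : R * R) (t u : tile) (D X : set (R * R)).
Implicit Types (g h : R -> R * R).

Lemma ltz_addr1 (x y : int) : x < y -> x%:~R + 1 <= y%:~R :> R.
Proof. by move=> xy; rewrite -(intrD _ x 1) ler_int; lia. Qed.

(* The intersection of two grid intervals is a face of each of them. *)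
Lemma grid_interval_face (x y : int) (a b l : R) :
    x%:~R <= a <= x%:~R + 1 -> x%:~R <= b <= x%:~R + 1 -> 0 <= l < 1 ->
    y%:~R <= a + l * (b - a) <= y%:~R + 1 ->
  y%:~R <= a <= y%:~R + 1.
Proof.
move=> /andP[xa ax] /andP[xb bx] /andP[l0 l1] /andP[h1 h2].
have [-> | ne] := eqVneq y x; first by rewrite xa ax.
case/orP: (lt_total ne) => /ltz_addr1 h; apply/andP; split; nra.
Qed.

(** Two tiles meet in a common face, and a face that contains an inner point of a segment of the
    tile contains the whole segment. Hence a segment inside a tile touches no other tile than those
    at its ends. *)
Lemma square_segment_face t u p q (l : R) :
    square t p -> square t q -> 0 <= l <= 1 ->
    square u (p + l *: (q - p)) -> square u p \/ square u q.
Proof.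
move=> /in_square[p1 p2] /in_square[q1 q2] /andP[l0].
rewrite le_eqVlt => /orP[/eqP->|l1].
  by rewrite scale1r addrC subrK; right.
move=> /in_square[u1 u2]; left; apply/in_square; split.
  by apply: (grid_interval_face p1 q1 _ u1); rewrite l0.
by apply: (grid_interval_face p2 q2 _ u2); rewrite l0.
Qed.

Lemma square_convex t p q (l : R) : square t p -> square t q -> 0 <= l <= 1 ->
  square t (p + l *: (q - p)).
Proof.
move=> /in_square[p1 p2] /in_square[q1 q2] /andP[l0 l1].
by apply/in_square => /=; split; rewrite /GRing.scale /=; apply/andP; split; nra.
Qed.

Definition path_in D g : Prop :=
  {within `[0, 1], continuous g} /\ g @` `[0, 1] `<=` D.

Definition touched D g : set tile :=
  [set t | tiles D t /\ square t `&` g @` `[0, 1] !=set0].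

Lemma touched_at D g t (s : R) : tiles D t -> 0 <= s <= 1 -> square t (g s) ->
  touched D g t.
Proof.
by move=> Dt s01 tgs; split=> //; exists (g s); split=> //; exists s;
  rewrite //= in_itv.
Qed.

Lemma const_path D p : D p -> path_in D (fun=> p).
Proof. by move=> Dp; split=> [|_ [s _ <-]//]; move=> x; exact: cvg_cst. Qed.

(** The segment from [p] to [g 0] stays in the convex tile [t] and is run through before [g];
    [square_segment_face] controls the tiles it touches. *)
Lemma extend_path D g t p :
    path_in D g -> tiles D t -> square t (g 0) -> square t p ->
  exists h, [/\ path_in D h, h 0 = p, h 1 = g 1 &
    touched D h `<=` touched D g `|` [set u | tiles D u /\ square u p]].
Proof.
move=> [cg gD] Dt tg0 tp.
(* One formula for the concatenation, continuous without gluing: until time 1/2 the argument [k s]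
   rests at 0 while the segment is traversed, and afterwards the second term vanishes. *)
pose k (s : R) := Num.max 0 (2 * s - 1).
pose h (s : R) := g (k s) + Num.max 0 (1 - 2 * s) *: (p - g 0).
have maxr x : 0 <= x -> Num.max 0 x = x :> R by move=> /max_r.
have maxl x : x <= 0 -> Num.max 0 x = 0 :> R by move=> /max_l.
have k01 s : 0 <= s <= 1 -> 0 <= k s <= 1.
  by move=> /andP[s0 s1]; rewrite /k le_max ge_max lexx ler01 /=; lra.
have hE s : 0 <= s <= 1 -> (1 / 2 <= s /\ h s = g (k s)) \/
    (0 <= 1 - 2 * s <= 1 /\ h s = g 0 + (1 - 2 * s) *: (p - g 0)).
  move=> /andP[s0 s1]; have [s2|s2] := leP (1 / 2) s.
    have s2' : 1 - 2 * s <= 0 by lra.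
    by left; rewrite /h (maxl _ s2') scale0r addr0.
  have [s2' s2''] : 2 * s - 1 <= 0 /\ 0 <= 1 - 2 * s by lra.
  by right; rewrite /h /k maxl // maxr //; split => //; lra.
have ck : continuous k.
  move=> s; apply: (@continuous_max _ _ (fun=> 0) (fun s : R => 2 * s - 1)).
    exact: cvg_cst.
  by apply: cvgB; [apply: cvgM; [exact: cvg_cst|exact: cvg_id]|exact: cvg_cst].
have cl : {within `[0, 1], continuous (fun s : R => Num.max 0 (1 - 2 * s))}.
  apply: continuous_subspaceT => s.
  apply: (@continuous_max _ _ (fun=> 0) (fun s : R => 1 - 2 * s)).
    exact: cvg_cst.
  by apply: cvgB; [exact: cvg_cst|apply: cvgM; [exact: cvg_cst|exact: cvg_id]].
have hg s : 0 <= s <= 1 -> (exists2 s', 0 <= s' <= 1 & h s = g s') \/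
    exists2 l, 0 <= l <= 1 & h s = g 0 + l *: (p - g 0).
  move=> s01; have [[_ ->]|[s2 ->]] := hE s s01.
    by left; exists (k s) => //; exact: k01.
  by right; exists (1 - 2 * s).
have cgk : {within `[0, 1], continuous (g \o k)}.
  apply: within_continuous_within cg; last exact: continuous_subspaceT.
  by move=> {}s /=; rewrite !in_itv; exact: k01.
exists h; split.
- split.
    move=> s; apply: cvgD; first exact: cgk.
    by apply: cvgZr_tmp; exact: cl.
  move=> _ [s /= + <-]; rewrite in_itv => /= s01.
  have [[s' s'01 ->]|[l l01 ->]] := hg s s01.
    by apply: gD; exists s'; rewrite //= in_itv.
  by apply: Dt; exact: square_convex.
- rewrite /h /k mulr0 subr0 sub0r maxl ?maxr ?ler01 ?lerN10 //.
  by rewrite scale1r addrC subrK.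
- have [[_ ->]|[/andP[h1 _] _]] := hE 1 ltac:(by rewrite ler01 lexx).
    have [k1 k2] : 0 <= 2 * 1 - 1 :> R /\ 2 * 1 - 1 = 1 :> R by lra.
    by rewrite /k maxr // k2.
  by exfalso; lra.
- move=> u [Du [x [ux [s /= + sx]]]]; rewrite in_itv /= => s01.
  move: ux; rewrite -sx; have [[s' s'01 ->]|[l l01 ->]] := hg s s01 => us.
    by left; exact: touched_at us.
  have [ug0|up] := square_segment_face tg0 tp l01 us; last by right.
  by left; apply: touched_at ug0; rewrite ?lexx ?ler01.
Qed.

(** The homeomorphism carries a segment of the convex unit disk to the path. *)
Lemma planar_disk_path D p q : planar_disk D -> D p -> D q ->
  exists g, [/\ path_in D g, g 0 = p & g 1 = q].
Proof.
move=> [f [k [cf _ fD kD [_ kK]]]] Dp Dq.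
pose l (s : R) := k p + s *: (k q - k p).
exists (f \o l); split; last 2 first.
- by rewrite /l /= scale0r addr0 kK ?inE.
- by rewrite /l /= scale1r addrC subrK kK ?inE.
have l_disk s : 0 <= s <= 1 -> (l s).1 ^+ 2 + (l s).2 ^+ 2 <= 1.
  move=> /andP[s0 s1]; have := kD _ Dp; have := kD _ Dq; rewrite /l /=.
  rewrite /GRing.scale /=.
  move: (k p) (k q) => [a b] [c d] /= => h1 h2.
  have := sqr_ge0 (a - c); have := sqr_ge0 (b - d).
  have : 0 <= s * (1 - s) by nra.
  nra.
split; last first.
  by move=> _ [s /= + <-]; rewrite in_itv => /= s01; apply: fD; exact: l_disk.
apply: within_continuous_within cf => [s /=|].
  by rewrite in_itv => /= /l_disk.
apply: continuous_subspaceT => s; apply: cvgD; first exact: cvg_cst.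
by apply: cvgZr_tmp; exact: cvg_id.
Qed.

End Paths.

(** * A disk which is a subcomplex is covered by its tiles *)

Section NoHair.
Context {R : realType}.
Implicit Types (p q r : R * R) (t u : tile) (D X : set (R * R)).

Definition gridval (x : R) : Prop := exists z : int, x = z%:~R.

Lemma not_gridval_between (z : int) (x : R) :
  z%:~R < x < z%:~R + 1 -> ~ gridval x.
Proof.
move=> h [y e]; move: h; rewrite e -[1]/(1%:~R) -intrD !ltr_int; lia.
Qed.

Lemma not_gridval_floor (x : R) : ~ gridval x ->
  (Num.floor x)%:~R < x < (Num.floor x)%:~R + 1.
Proof.
move=> xZ; rewrite -[X in _ + X]/(1%:~R) -intrD lt_neqAle.
rewrite floorD1_gt andbT ge_floor andbT.
by apply/eqP => h; apply: xZ; exists (Num.floor x).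
Qed.

(** Two different integer end values would force, by the intermediate value theorem, a value halfway
    between consecutive integers. *)
Lemma gridval_path_constant (f : R -> R) :
    {within `[0, 1], continuous f} ->
    (forall s, 0 <= s <= 1 -> gridval (f s)) ->
  f 0 = f 1.
Proof.
move=> cf fZ; have [[x fx] [y fy]] : gridval (f 0) /\ gridval (f 1).
  by split; apply: fZ; rewrite ?lexx ?ler01.
have [z zxy] : exists z : int,
    f 0 != f 1 -> Num.min (f 0) (f 1) <= z%:~R + 1 / 2 <= Num.max (f 0) (f 1).
  exists (Num.min x y); rewrite fx fy eqr_int => /lt_total/orP[] xy.
    have := @ltz_addr1 R _ _ xy; have : x%:~R <= y%:~R :> R by rewrite ler_int ltW.
    rewrite (min_l (ltW xy)) => xy'; rewrite min_l // max_r //.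
    by move=> h; apply/andP; split; lra.
  have := @ltz_addr1 R _ _ xy; have : y%:~R <= x%:~R :> R by rewrite ler_int ltW.
  rewrite (min_r (ltW xy)) => xy'; rewrite min_r // max_l //.
  by move=> h; apply/andP; split; lra.
apply/eqP/negPn/negP => /zxy/(IVT ler01 cf)[c]; rewrite in_itv /= => /fZ + cz.
by rewrite cz; apply: (@not_gridval_between z); apply/andP; split; lra.
Qed.

Lemma ball_segment p q r (e s : R) : `|p - q| < e -> `|p - r| < e ->
  0 <= s <= 1 -> `|p - (q + s *: (r - q))| < e.
Proof.
move=> pq pr /andP[s0 s1].
have -> : p - (q + s *: (r - q)) = (1 - s) *: (p - q) + s *: (p - r).
  rewrite scalerBl scale1r !scalerBr !opprD !opprK !addrA.
  by case: p q r {pq pr} => [? ?] [? ?] [? ?]; congr pair;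
    rewrite /= /GRing.scale /=; ring.
apply: le_lt_trans (ler_normD _ _) _; rewrite !normrZ.
rewrite [`|1 - s|]ger0_norm ?subr_ge0 // [`|s|]ger0_norm //.
move: (`|p - q|) (`|p - r|) pq pr => a b ae be.
by have [s2|s2] := leP s (1 / 2); nra.
Qed.

(* By the intermediate value theorem, an injective real function cannot be
   continuous on a triangle. *)
Lemma no_gridval_immersion p (e : R) (f g : R * R -> R) : 0 < e ->
    let B := [set q | `|p - q| < e] in
    {within B, continuous f} -> {within B, continuous g} ->
    (forall q, B q -> gridval (g q)) ->
    (forall q r, B q -> B r -> f q = f r -> g q = g r -> q = r) ->
  False.
Proof.
move=> e0 B cf cg gZ inj.
pose seg q r (s : R) := q + s *: (r - q).
have seg_cont q r : {within `[0, 1], continuous (seg q r)}.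
  apply: continuous_subspaceT => s; apply: cvgD; first exact: cvg_cst.
  by apply: cvgZr_tmp; exact: cvg_id.
have segB q r (s : R) : B q -> B r -> s \in `[0, 1] -> B (seg q r s).
  by move=> Bq Br; rewrite in_itv /=; exact: ball_segment.
have segE q r : seg q r 0 = q /\ seg q r 1 = r.
  by rewrite /seg scale0r addr0 scale1r addrC subrK.
have seg_comp q r (h : R * R -> R) : B q -> B r ->
    {within B, continuous h} -> {within `[0, 1], continuous (h \o seg q r)}.
  move=> Bq Br ch; apply: within_continuous_within ch => // s.
  by move=> /mem_set; rewrite inE; exact: segB.
(* Being integer valued on a convex set, [g] is constant there, so [f] alone must be injective. *)
have gconst q r : B q -> B r -> g q = g r.
  move=> Bq Br; have [E0 E1] := segE q r; rewrite -[in LHS]E0 -[in RHS]E1.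
  apply: (@gridval_path_constant (g \o seg q r)); first exact: seg_comp.
  by move=> s s01; apply: gZ; apply: segB => //; rewrite in_itv.
(* A value of [f] between those at [q] and [r] is already taken on the segment from [q] to [r], so
   injectivity puts [z] on that segment. *)
have nobetween q r z : B q -> B r -> B z ->
    (forall s, z <> seg q r s) ->
    ~ (Num.min (f q) (f r) <= f z <= Num.max (f q) (f r)).
  move=> Bq Br Bz zseg; have [E0 E1] := segE q r.
  have := @IVT _ _ _ _ (f z) ler01 (seg_comp q r f Bq Br cf).
  rewrite /= E0 E1 => ivt /ivt[s s01 fs].
  apply: (zseg s); apply: inj => //; first exact: segB.
  by apply: gconst => //; exact: segB.
have Bp : B p by rewrite /B /= subrr normr0.
pose q := p + (e / 2, 0); pose r := p + (0, e / 2).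
have Bq : B q.
  rewrite /B /q /= opprD addrA subrr sub0r normrN prod_normE /= normr0.
  by rewrite gtr0_norm ?max_l //; lra.
have Br : B r.
  rewrite /B /r /= opprD addrA subrr sub0r normrN prod_normE /= normr0.
  by rewrite gtr0_norm ?max_r //; lra.
have eqP2 (x y : R * R) : x = y -> x.1 = y.1 /\ x.2 = y.2 by move=> ->.
have := nobetween p q r Bp Bq Br; have := nobetween p r q Bp Br Bq.
have := nobetween q r p Bq Br Bp.
have n1 s : p <> seg q r s.
  move=> /eqP2[]; rewrite /seg /q /r /= /GRing.scale /= => h1 h2.
  by have : (1 - s) * e = 0 /\ s * e = 0 by [split; lra]; nra.
have n2 s : q <> seg p r s.
  by move=> /eqP2[]; rewrite /seg /q /r /= /GRing.scale /= => h1 _; lra.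
have n3 s : r <> seg p q s.
  by move=> /eqP2[]; rewrite /seg /q /r /= /GRing.scale /= => _ h2; lra.
(* None of the three vertices lies on the opposite side, yet one of three real values always lies
   between the other two. *)
move=> /(_ n1) h1 /(_ n2) h2 /(_ n3) h3.
move: h1 h2 h3; move: (f p) (f q) (f r) => a b c.
by case: (leP a b); case: (leP b c); case: (leP a c); lra.
Qed.

Lemma subcomplex_tile X q : subcomplex X -> X q ->
  (exists2 t, tiles X t & square t q) \/ gridval q.1 \/ gridval q.2.
Proof.
move=> [C ->] [[[x y] [bw bh]] /= Cc cq].
case: bw bh Cc cq => [] [] Cc cq.
- by left; exists (x, y) => // p; exists (x, y, (true, true)).
- by right; right; exists y; move: cq => [_]; rewrite /= addr0; lra.
- by right; left; exists x; move: cq => [+ _]; rewrite /= addr0; lra.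
- by right; left; exists x; move: cq => [+ _]; rewrite /= addr0; lra.
Qed.

(** A point off the grid lines lies in no vertex or edge of the tiling, and in a single tile. *)
Lemma open_square_tile X t q : subcomplex X -> X q ->
    t.1%:~R < q.1 < t.1%:~R + 1 -> t.2%:~R < q.2 < t.2%:~R + 1 ->
  tiles X t.
Proof.
move=> sX Xq q1 q2; have [[u Xu /in_square[u1 u2]]|[]] := subcomplex_tile sX Xq.
- suff -> : t = u by [].
  have same (x y : int) (a : R) : x%:~R < a < x%:~R + 1 ->
      y%:~R <= a <= y%:~R + 1 -> x = y.
    move=> xa ya; apply/eqP.
    by apply: contraT => /lt_total/orP[]/(@ltz_addr1 R); lra.
  by rewrite [t]surjective_pairing (same _ _ _ q1 u1) (same _ _ _ q2 u2)
    -surjective_pairing.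
- by move/not_gridval_between: q1.
- by move/not_gridval_between: q2.
Qed.

(* Away from its tiles the disk lies on the grid lines, where there is no room
   for an open piece of the plane. *)
Lemma planar_disk_tile D p : planar_disk D -> subcomplex D -> D p ->
  exists2 t, tiles D t & square t p.
Proof.
move=> dD sD Dp; apply: contrapT => notile.
pose K := \bigcup_(t in tiles D) (square t : set (R * R)).
have DK q : D q -> ~ K q -> gridval q.1 \/ gridval q.2.
  move=> Dq Kq; have [[t Dt tq]|//] := subcomplex_tile sD Dq.
  by exfalso; apply: Kq; exists t.
(* The finitely many tiles form a closed set missing [p], so a whole ball around [p] misses it. *)
have [e e0 pK] : exists2 e, 0 < e & forall q, `|p - q| < e -> ~ K q.
  have : open (~` K) by apply: closed_openC; exact/squares_closed/tiles_finite.
  have nKp : (~` K) p by move=> [t Dt tp]; apply: notile; exists t.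
  by rewrite openE => /(_ p nKp)/nbhs_normP[e e0 pK]; exists e.
have [f [h [cf _ fD hD [fK hK]]]] := dD.
pose disk := [set p : R * R | p.1 ^+ 2 + p.2 ^+ 2 <= 1].
have hpD : disk (h p) := hD _ Dp.
have [d d0 fd] := (within_continuousP _ _).1 cf _ hpD e e0.
(* The preimage [h p] may lie on the boundary circle; it is moved toward the origin, by less than
   [d], to reach the open disk. *)
pose l : R := Num.min 1 (d / (`|h p| + 1) / 2).
have [l0 l1 ld] : [/\ 0 < l, l <= 1 & l * `|h p| < d].
  have n0 : 0 < `|h p| + 1 by rewrite ltr_wpDl.
  have l0 : 0 < l by rewrite lt_min ltr01 !divr_gt0.
  split => //; first by rewrite ge_min lexx.
  apply: (@le_lt_trans _ _ (d / 2)); last by lra.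
  apply: (@le_trans _ _ (d / (`|h p| + 1) / 2 * (`|h p| + 1))).
    apply: ler_pM; [exact: ltW|exact: normr_ge0| |lra].
    by rewrite ge_min lexx orbT.
  by rewrite mulrAC divfK // gt_eqF.
pose x : R * R := (1 - l) *: h p.
have xd : `|h p - x| < d.
  rewrite /x scalerBl scale1r opprB addrC subrK normrZ gtr0_norm //.
have xdisk : x.1 ^+ 2 + x.2 ^+ 2 < 1.
  move: hpD; rewrite /disk /x /= /GRing.scale /=.
  move: (h p).1 (h p).2 => a b ab.
  have : (1 - l) ^+ 2 < 1 by nra.
  have := sqr_ge0 a; have := sqr_ge0 b; nra.
have [r r0 Br] : exists2 r, 0 < r & forall z, `|x - z| < r ->
    disk z /\ `|h p - z| < d.
  have cn (q : R * R) : continuous (fun z : R * R => `|q - z|).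
    move=> z; apply: cvg_norm; apply: cvgB; [exact: cvg_cst|exact: cvg_id].
  have csq : continuous (fun z : R * R => z.1 ^+ 2 + z.2 ^+ 2).
    move=> z; apply: cvgD; apply: (@cvg_comp _ _ _ _ (fun x => x ^+ 2)).
    - exact: continuous_fst.
    - exact: exprn_continuous.
    - exact: continuous_snd.
    - exact: exprn_continuous.
  have : nbhs x ([set z : R * R | z.1 ^+ 2 + z.2 ^+ 2 < 1] `&`
      [set z | `|h p - z| < d]).
    apply: filterI.
      by apply: (csq x [set y | y < 1]); exact: (lt_nbhsl (xdisk)).
    by apply: (cn (h p) x [set y | y < d]); exact: lt_nbhsl.
  by move=> /nbhs_normP[r r0 Br]; exists r => // z /Br[/= /ltW].
have Binj (B : set (R * R)) : (forall z, B z -> disk z) -> forall y z,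
    B y -> B z -> (f y).1 = (f z).1 -> (f y).2 = (f z).2 -> y = z.
  move=> Bd y z /Bd yd /Bd zd h1 h2; rewrite -[LHS]fK ?inE // -[RHS]fK ?inE //.
  by congr h; rewrite [f y]surjective_pairing h1 h2 -surjective_pairing.
have ccoord (B : set (R * R)) : (forall z, B z -> disk z) ->
    {within B, continuous (fst \o f)} /\ {within B, continuous (snd \o f)}.
  move=> Bd; have cB : {within B, continuous f}.
    by apply: continuous_subspaceW cf => z /Bd.
  split; apply: (within_continuous_within (B := setT)) cB _ => //.
    by apply: continuous_subspaceT; exact: continuous_fst.
  by apply: continuous_subspaceT; exact: continuous_snd.
have fZ z : `|x - z| < r -> gridval (f z).1 \/ gridval (f z).2.
  move=> /Br[zd zx]; apply: DK; first exact: fD.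
  by apply: pK; have := fd z zd zx; rewrite hK ?inE.
(* If the first coordinate of [f] leaves the grid at some point, it stays off the grid nearby, and
   there the second coordinate is always on it. Otherwise the first one is always on the grid. Both
   cases contradict [no_gridval_immersion]. *)
have [[z0 xz0 z0Z]|allZ] :=
    pselect (exists2 z, `|x - z| < r & ~ gridval (f z).1).
  have [h1 h2] := andP (not_gridval_floor z0Z).
  set m := Num.floor _ in h1 h2.
  have [c1 _] := ccoord [set z | `|x - z| < r] (fun z h => proj1 (Br z h)).
  pose e1 := Num.min ((f z0).1 - m%:~R) (m%:~R + 1 - (f z0).1).
  have e10 : 0 < e1 by rewrite lt_min !subr_gt0 h1 h2.
  have [d1 d10 fd1] := (within_continuousP _ _).1 c1 z0 xz0 e1 e10.
  pose r1 := Num.min d1 (r - `|x - z0|).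
  have r10 : 0 < r1 by rewrite lt_min d10 subr_gt0.
  have B1 z : `|z0 - z| < r1 -> `|x - z| < r.
    rewrite lt_min => /andP[_ zr]; have := ler_normD (x - z0) (z0 - z).
    by rewrite addrA subrK; lra.
  have [c2 c3] :=
    ccoord [set z | `|z0 - z| < r1] (fun z h => proj1 (Br z (B1 z h))).
  apply: (no_gridval_immersion r10 c2 c3) => /=.
    move=> z zr1; have [|//] := fZ z (B1 z zr1).
    move=> zZ; exfalso; apply: (@not_gridval_between m (f z).1) zZ.
    have /= := fd1 z (B1 z zr1) _; rewrite lt_min in zr1.
    move=> /(_ (proj1 (andP zr1))); rewrite /e1 lt_min !ltr_norml.
    by move=> /andP[/andP[? ?] /andP[? ?]]; apply/andP; split; lra.
  by move=> y z yr zr h3 h4; apply: (Binj [set z | `|z0 - z| < r1]) h3 h4 => //;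
    move=> w /= /B1/Br[].
have [c2 c3] := ccoord [set z | `|x - z| < r] (fun z h => proj1 (Br z h)).
apply: (no_gridval_immersion r0 c3 c2) => /=.
  by move=> z xz; apply: contrapT => nZ; apply: allZ; exists z.
by move=> y z yr zr h3 h4; apply: (Binj [set z | `|x - z| < r]) h4 h3 => //;
  move=> w /= /Br[].
Qed.

End NoHair.

(** * The frontier *)

Section Frontier.
Context {R : realType}.
Implicit Types (p q r : R * R) (t u : tile) (D X : set (R * R)).

Lemma grid_interval_eq (x y : int) (a : R) : ~ gridval a ->
  x%:~R <= a <= x%:~R + 1 -> y%:~R <= a <= y%:~R + 1 -> x = y.
Proof.
move=> aZ xa ya; apply/eqP; apply: contra_notT aZ => /lt_total/orP[].
  by move=> /(@ltz_addr1 R) xy; exists y; lra.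
by move=> /(@ltz_addr1 R) yx; exists x; lra.
Qed.

Lemma grid_interval_succ (x y : int) (a : R) : x < y ->
    x%:~R <= a <= x%:~R + 1 -> y%:~R <= a <= y%:~R + 1 ->
  a = y%:~R /\ y%:~R = x%:~R + 1 :> R.
Proof. by move=> /(@ltz_addr1 R) xy xa ya; split; lra. Qed.

Lemma grid_interval_two (x y z : int) (a : R) : x <> y ->
    x%:~R <= a <= x%:~R + 1 -> y%:~R <= a <= y%:~R + 1 ->
    z%:~R <= a <= z%:~R + 1 ->
  z = x \/ z = y.
Proof.
wlog xy : x y / x < y.
  move=> W xy xa ya za; have [h|h|h] := ltgtP x y; last by case: xy.
    exact: W.
  by have [] := W y x h (nesym xy) ya xa za; [right|left].
move=> _ xa ya za; have [aE yE] := grid_interval_succ xy xa ya.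
have yx : y = x + 1 by apply/eqP; rewrite -(eqr_int R) intrD; apply/eqP.
have zy : z <= y by rewrite -(ler_int R); lra.
have yz : y <= z + 1 by rewrite -(ler_int R) intrD; lra.
clear -yx zy yz; lia.
Qed.

Lemma interiorP D p (e : R) : 0 < e -> (forall q, `|p - q| < e -> D q) ->
  D° p.
Proof. by move=> e0 De; apply: (nbhs_normP p D).2; exists e. Qed.

Lemma norm_coord_lt p q (e : R) : `|p - q| < e ->
  - e < p.1 - q.1 < e /\ - e < p.2 - q.2 < e.
Proof.
move=> pq; rewrite -!ltr_norml.
by split; apply: le_lt_trans pq; [exact: (norm_fst_le (p - q)) |
  exact: (norm_snd_le (p - q))].
Qed.

Lemma rect_interior D (x y : int) (w h : nat) p : rect x y w h `<=` D ->
    x%:~R < p.1 < (x + w%:Z)%:~R -> y%:~R < p.2 < (y + h%:Z)%:~R ->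
  D° p.
Proof.
move=> rD /andP[p1 p2] /andP[p3 p4].
pose e := Num.min (Num.min (p.1 - x%:~R) ((x + w%:Z)%:~R - p.1))
                  (Num.min (p.2 - y%:~R) ((y + h%:Z)%:~R - p.2)).
apply: (@interiorP _ _ e); first by rewrite !lt_min !subr_gt0 p1 p2 p3 p4.
move=> q pq; apply: rD; have [h1 h2] := norm_coord_lt pq.
move: h1 h2; rewrite /rect /=.
have : e <= p.1 - x%:~R by rewrite !ge_min lexx.
have : e <= (x + w%:Z)%:~R - p.1 by rewrite !ge_min lexx !orbT.
have : e <= p.2 - y%:~R by rewrite !ge_min lexx !orbT.
have : e <= (y + h%:Z)%:~R - p.2 by rewrite !ge_min lexx !orbT.
by move: e {pq} => e *; split; apply/andP; split; lra.
Qed.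

(** Since the point is not a vertex, the two tiles share a side; their union is a rectangle two
    tiles long that has the point strictly inside. *)
Lemma two_tiles_interior D t u p : tiles D t -> tiles D u -> t <> u ->
    square t p -> square u p -> ~ (gridval p.1 /\ gridval p.2) ->
  D° p.
Proof.
move=> Dt Du tu /in_square[t1 t2] /in_square[u1 u2] pZ.
have [p1Z|p1Z] := pselect (gridval p.1).
  have p2Z : ~ gridval p.2 by move=> ?; apply: pZ.
  have tu2 := grid_interval_eq p2Z t2 u2.
  have := not_gridval_floor p2Z.
  wlog tu1 : t u Dt Du tu t1 t2 u1 u2 tu2 / t.1 < u.1.
    move=> W; have [h|h|h] := ltgtP t.1 u.1; first exact: (W t u).
      by apply: (W u t) => // /esym.
    by exfalso; apply: tu; rewrite [t]surjective_pairing [u]surjective_pairing h tu2.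
  have [p1E uE] := grid_interval_succ tu1 t1 u1.
  rewrite (@grid_interval_eq (Num.floor p.2) t.2 p.2 p2Z) //; last first.
    by have := not_gridval_floor p2Z; lra.
  move=> fl; apply: (@rect_interior _ t.1 t.2 2 1); last 2 first.
  - by rewrite intrD; lra.
  - by rewrite intrD; lra.
  move=> q; rewrite /rect /= !intrD => -[q1 q2].
  have [h|h] := leP q.1 u.1%:~R.
    by apply: Dt; apply/in_square; split; lra.
  by apply: Du; apply/in_square; rewrite -tu2; split; lra.
have tu1 := grid_interval_eq p1Z t1 u1.
wlog tu2 : t u Dt Du tu t1 t2 u1 u2 tu1 / t.2 < u.2.
  move=> W; have [h|h|h] := ltgtP t.2 u.2; first exact: (W t u).
    by apply: (W u t) => // /esym.
  by exfalso; apply: tu; rewrite [t]surjective_pairing [u]surjective_pairing h tu1.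
have [p2E uE] := grid_interval_succ tu2 t2 u2.
have := not_gridval_floor p1Z.
rewrite (@grid_interval_eq (Num.floor p.1) t.1 p.1 p1Z) //; last first.
  by have := not_gridval_floor p1Z; lra.
move=> fl; apply: (@rect_interior _ t.1 t.2 1 2); last 2 first.
- by rewrite intrD; lra.
- by rewrite intrD; lra.
move=> q; rewrite /rect /= !intrD => -[q1 q2].
have [h|h] := leP q.2 u.2%:~R.
  by apply: Dt; apply/in_square; split; lra.
by apply: Du; apply/in_square; rewrite -tu1; split; lra.
Qed.

Lemma nearby_parameter (u v s d : R) : u < v -> u <= s <= v -> 0 < d ->
  exists s', [/\ u <= s' <= v, s' != s & `|s - s'| < d].
Proof.
move=> uv /andP[us sv] d0; have [->|ne] := eqVneq s v.
  exists (Num.max u (v - d / 2)); split.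
  - by rewrite le_max ge_max lexx /= (ltW uv) /=; lra.
  - by rewrite lt_eqF // gt_max uv /=; lra.
  - by rewrite ltr_norml; case: (leP u (v - d / 2)) => ?; apply/andP; split; lra.
have {ne}sv : s < v by rewrite lt_neqAle ne sv.
exists (Num.min v (s + d / 2)); split.
- by rewrite ge_min le_min lexx /= (ltW uv) /=; lra.
- by rewrite gt_eqF // lt_min sv /=; lra.
- by rewrite ltr_norml; case: (leP v (s + d / 2)) => ?; apply/andP; split; lra.
Qed.

Lemma gridval_near (x y : int) : - 1 < (x%:~R - y%:~R : R) < 1 -> x = y.
Proof.
rewrite -intrB => /andP[h1 h2]; have : -1 < x - y by rewrite -(ltr_int R) intrN.
by have : x - y < 1 by [rewrite -(ltr_int R)]; lia.
Qed.

(* Moving a little along the frontier avoids the vertices of the tiling, and a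
   frontier point which is not a vertex lies in exactly one tile. *)
Lemma frontier_arc_tile D (g : R -> R * R) (u v s : R) :
    planar_disk D -> subcomplex D -> clockwise_boundary_loop D g ->
    0 <= u -> u < v -> v < 1 -> u <= s <= v ->
  exists s' t, [/\ u <= s' <= v, tiles D t, square t (g s), square t (g s') &
    ~ (gridval (g s').1 /\ gridval (g s').2)] /\
    (forall t', tiles D t' -> square t' (g s') -> t' = t).
Proof.
move=> dD sD [cg _ ginj gim _] u0 uv v1 s_uv.
have gF s' : u <= s' <= v -> frontier D (g s').
  by move=> s'uv; rewrite -gim; exists s' => //=; rewrite in_itv /=; lra.
have gD s' : u <= s' <= v -> D (g s').
  by move=> /gF[+ _]; rewrite -(closure_id D).1 //; exact: planar_disk_closed.
suff [s' [s'uv s'Z s's]] : exists s', [/\ u <= s' <= v,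
    ~ (gridval (g s').1 /\ gridval (g s').2) &
    forall t, tiles D t -> square t (g s') -> square t (g s)].
  have [t Dt ts'] := planar_disk_tile dD sD (gD _ s'uv).
  exists s', t; split; first by split => //; exact: s's.
  move=> t' Dt' t's'; apply: contrapT => tt'.
  by case: (gF _ s'uv) => _; apply; exact: (two_tiles_interior Dt' Dt).
have [[[x sx] [y sy]]|sZ] := pselect (gridval (g s).1 /\ gridval (g s).2);
  last by exists s.
(* The tiles that miss [g s] form a closed set, so every tile containing a point close enough to
   [g s] also contains [g s]. *)
pose K := \bigcup_(t in tiles D `&` [set t | ~ square t (g s)])
  (square t : set (R * R)).
have [e e0 sK] : exists2 e, 0 < e & forall q, `|g s - q| < e -> ~ K q.
  have : open (~` K).
    apply/closed_openC/squares_closed; apply: sub_finite_set (tiles_finite dD).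
    by move=> ? [].
  have nK : (~` K) (g s) by move=> [t [_ nts] ts].
  by rewrite openE => /(_ _ nK)/nbhs_normP[e e0 eK]; exists e.
have s01 : `[0, 1]%classic s by rewrite /= in_itv /=; lra.
have m0 : 0 < Num.min e 1 by rewrite lt_min e0 ltr01.
have [d d0 gd] := (within_continuousP _ _).1 cg s s01 _ m0.
have [s' [s'uv s's /gd]] := nearby_parameter uv s_uv d0.
rewrite lt_min => /(_ ltac:(by rewrite /= in_itv /=; lra))/andP[ge g1].
exists s'; split => //; last first.
  move=> t Dt ts'; apply: contrapT => nts.
  by apply: (sK _ ge); exists t.
(* Two vertices less than 1 apart in each coordinate coincide, which injectivity of the loop rules
   out. *)
move=> [[x' s'x] [y' s'y]]; move/eqP: s's; apply.
apply: ginj; rewrite ?in_itv /=; try (apply/andP; split; lra).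
have [h1 h2] := norm_coord_lt g1.
rewrite [g s']surjective_pairing [g s]surjective_pairing sx sy s'x s'y.
rewrite sx s'x in h1; rewrite sy s'y in h2.
by rewrite (gridval_near h1) (gridval_near h2).
Qed.

End Frontier.

(** * The levels of a weight function *)

Section Potential.
Context {R : realType} (D : dumbbell R).
Implicit Types (rho : tile -> R) (g h : R -> R * R) (t u : tile).
Implicit Types (p q : R * R).

Let diskD := qdisk_disk D.

Lemma quad_edge_sub (u v : R) : 0 <= u -> v <= 1 ->
  qloop D @` `[u, v] `<=` frontier D.
Proof.
move=> u0 v1 _ [s /= + <-]; rewrite in_itv /= => suv.
by have [_ _ _ <- _] := qloop_clockwise D; exists s => //=; rewrite in_itv /=; lra.
Qed.

Lemma qloop_params : [/\ 0 < qb D, qb D < qc D, qc D < qd D & qd D < 1].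
Proof. by split; [exact: qb_gt0|exact: qb_lt_qc|exact: qc_lt_qd|exact: qd_lt1]. Qed.

Lemma frontier_sub : frontier D `<=` D.
Proof. by move=> p [+ _]; rewrite -(closure_id _).1 //; exact: planar_disk_closed. Qed.

Lemma top_edge_frontier : top_edge D `<=` frontier D.
Proof. by have [? ? ? ?] := qloop_params; apply: quad_edge_sub; lra. Qed.

Lemma bottom_edge_frontier : bottom_edge D `<=` frontier D.
Proof. by have [? ? ? ?] := qloop_params; apply: quad_edge_sub; lra. Qed.

Lemma top_edge_a : top_edge D (qloop D 0).
Proof.
by have [b0 bc cd d1] := qloop_params; exists 0 => //=; rewrite in_itv /=; lra.
Qed.

Lemma bottom_edge_c : bottom_edge D (qloop D (qc D)).
Proof.
by have [? ? ? ?] := qloop_params; exists (qc D) => //=; rewrite in_itv /=; lra.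
Qed.

(** This makes the infimum in [rho_height] one over a nonempty set. *)
Lemma joining_path : exists g, joins_top_bottom D g.
Proof.
have [g [[cg gD] g0 g1]] := planar_disk_path diskD
  (frontier_sub (top_edge_frontier top_edge_a))
  (frontier_sub (bottom_edge_frontier bottom_edge_c)).
exists g; split=> //; rewrite ?g0 ?g1; [exact: top_edge_a|exact: bottom_edge_c].
Qed.

Definition tile_seq : seq tile := finmap.enum_fset (fset_set (tiles D)).

Lemma mem_tile_seq t : (t \in tile_seq) = `[< tiles D t >].
Proof.
rewrite /tile_seq in_fset_set; last exact: tiles_finite.
by apply/idP/asboolP; rewrite inE.
Qed.

Lemma tile_seq_uniq : uniq tile_seq.
Proof. exact: finmap.fset_uniq. Qed.

Lemma rho_areaE rho : rho_area D rho = \sum_(t <- tile_seq) rho t ^+ 2.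
Proof. by rewrite /rho_area fsbig_finite //; exact: tiles_finite. Qed.

Lemma rho_lengthE rho g :
  rho_length D rho g = \sum_(t <- tile_seq | `[< touched D g t >]) rho t.
Proof.
rewrite -big_filter fsbig_seq ?filter_uniq ?tile_seq_uniq //.
apply: eq_fsbigl; apply/seteqP; split=> t /=.
  by move=> gt; rewrite mem_filter mem_tile_seq; apply/andP; split;
    apply/asboolP => //; case: gt.
by rewrite mem_filter => /andP[/asboolP].
Qed.

(** * Lengths, height and levels of a nonnegative weight *)

Section Nonnegative.
Variables (rho : tile -> R) (rho_ge0 : forall t, tiles D t -> 0 <= rho t).

Lemma rho_length_ge0 g : 0 <= rho_length D rho g.
Proof. by rewrite rho_lengthE; apply: sumr_ge0 => t /asboolP[/rho_ge0]. Qed.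

Lemma rho_length_touched g t : touched D g t -> rho t <= rho_length D rho g.
Proof.
move=> gt; have [Dt _] := gt.
rewrite rho_lengthE big_mkcond (bigD1_seq t) ?tile_seq_uniq //=; last first.
  by rewrite mem_tile_seq; apply/asboolP.
rewrite (asboolT gt) lerDl; apply: sumr_ge0 => u _.
by case: asboolP => // -[/rho_ge0].
Qed.

Lemma rho_length_add1 g h t : tiles D t ->
    touched D h `<=` touched D g `|` [set t] ->
  rho_length D rho h <= rho_length D rho g + rho t.
Proof.
move=> Dt hg; rewrite !rho_lengthE.
have -> : rho t = \sum_(u <- tile_seq | u == t) rho u.
  rewrite big_mkcond (bigD1_seq t) ?tile_seq_uniq //=; last first.
    by rewrite mem_tile_seq; apply/asboolP.
  by rewrite eqxx big1 ?addr0 // => u /negPf->.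
rewrite big_mkcond [X in _ <= X + _]big_mkcond [X in _ <= _ + X]big_mkcond.
rewrite -big_split /= big_seq [X in _ <= X]big_seq; apply: ler_sum => u.
rewrite mem_tile_seq => /asboolP/rho_ge0 u0.
case: asboolP => [/hg[gu|->]|_]; last by do 2 case: ifP => _; lra.
  by rewrite (asboolT gu); case: ifP => _; lra.
by have t0 := rho_ge0 Dt; rewrite eqxx; case: ifP => _; lra.
Qed.

Lemma rho_length_mono g h : touched D h `<=` touched D g ->
  rho_length D rho h <= rho_length D rho g.
Proof.
move=> hg; rewrite !rho_lengthE big_mkcond [X in _ <= X]big_mkcond.
rewrite big_seq [X in _ <= X]big_seq; apply: ler_sum => u.
rewrite mem_tile_seq => /asboolP/rho_ge0 u0.
case: asboolP => [/hg gu|_]; first by rewrite (asboolT gu).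
by case: ifP.
Qed.

Lemma rho_height_le g : joins_top_bottom D g ->
  rho_height D rho <= rho_length D rho g.
Proof.
move=> jg; apply: ge_inf; last by exists g.
by exists 0 => _ [h _ <-]; exact: rho_length_ge0.
Qed.

Lemma rho_height_ge (c : R) :
    (forall g, joins_top_bottom D g -> c <= rho_length D rho g) ->
  c <= rho_height D rho.
Proof.
move=> cg; apply: lb_le_inf; last by move=> _ [g jg <-]; exact: cg.
by have [g jg] := joining_path; exists (rho_length D rho g), g.
Qed.

(* Levels are measured from the bottom edge, as the rows of the bar. *)
Definition descent t g : Prop :=
  [/\ path_in D g, square t (g 0) & bottom_edge D (g 1)].

Definition upper_level t : R := inf [set rho_length D rho g | g in descent t].

Definition lower_level t : R := upper_level t - rho t.

Lemma upper_level_le t g : descent t g -> upper_level t <= rho_length D rho g.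
Proof.
move=> dg; apply: ge_inf; last by exists g.
by exists 0 => _ [h _ <-]; exact: rho_length_ge0.
Qed.

Lemma upper_level_ge t (c : R) : tiles D t ->
    (forall g, descent t g -> c <= rho_length D rho g) ->
  c <= upper_level t.
Proof.
move=> Dt cg; apply: lb_le_inf; last by move=> _ [g jg <-]; exact: cg.
have tp : square t (t.1%:~R : R, t.2%:~R : R) by apply/in_square => /=; lra.
have [g [pg g0 g1]] := planar_disk_path diskD (Dt _ tp)
  (frontier_sub (bottom_edge_frontier bottom_edge_c)).
exists (rho_length D rho g), g => //.
by split; rewrite ?g0 ?g1 //; exact: bottom_edge_c.
Qed.

Lemma path_touched0 g t : tiles D t -> square t (g 0) -> touched D g t.
Proof. by move=> Dt tg; apply: (touched_at (s := 0)); rewrite ?lexx ?ler01. Qed.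

(** A point where a path can pass from [t] to [u] without touching a third tile. For [t = u], the
    tile is alone at the point. *)
Definition only_tiles t u p : Prop :=
  [/\ square t p, square u p &
   forall t', tiles D t' -> square t' p -> t' = t \/ t' = u].

(** A descent from [t], prolonged inside [t] to start at [p], is a descent from [u] and touches at
    most [u] in addition. *)
Lemma lower_upper_level t u p : tiles D t -> tiles D u -> only_tiles t u p ->
  lower_level u <= upper_level t.
Proof.
move=> Dt Du [tp up only]; apply: upper_level_ge => // g [gD tg bg].
have [h [hD h0 h1 hg]] := extend_path gD Dt tg tp.
have dh : descent u h by split=> //; rewrite ?h0 ?h1.
rewrite lerBlDr; apply: le_trans (upper_level_le dh) _.
apply: rho_length_add1 => // t' /hg[|[/only/[apply]]]; first by left.
by case=> ->; [left; exact: path_touched0|right].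
Qed.

(** The constant path at [p] is a descent that touches [t] alone. *)
Lemma lower_level_bottom t p : tiles D t -> only_tiles t t p ->
  bottom_edge D p -> lower_level t <= 0.
Proof.
move=> Dt [tp _ only] bp; rewrite subr_le0.
have dp : descent t (fun=> p).
  by split=> //; apply: const_path; exact/frontier_sub/bottom_edge_frontier.
apply: le_trans (upper_level_le dp) _.
have -> : rho t = \sum_(u <- tile_seq | u == t) rho u.
  rewrite big_mkcond (bigD1_seq t) ?tile_seq_uniq //=; last first.
    by rewrite mem_tile_seq; apply/asboolP.
  by rewrite eqxx big1 ?addr0 // => u /negPf->.
rewrite rho_lengthE big_mkcond [leRHS]big_mkcond big_seq [leRHS]big_seq.
apply: ler_sum => u; rewrite mem_tile_seq => /asboolP Du.
have u0 := rho_ge0 Du; case: asboolP => [[_ [x [ux [s _ px]]]]|_].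
  by rewrite -px in ux; case: (only _ Du ux) => ->; rewrite eqxx.
by case: ifP.
Qed.

(** A descent from [t], prolonged to start at [p], joins top to bottom and touches no new tile. *)
Lemma upper_level_top t p : tiles D t -> only_tiles t t p ->
  top_edge D p -> rho_height D rho <= upper_level t.
Proof.
move=> Dt [tp _ only] topp; apply: upper_level_ge => // g [gD tg bg].
have [h [[ch hD] h0 h1 hg]] := extend_path gD Dt tg tp.
apply: le_trans (rho_height_le (g := h) _) _; first by split=> //; rewrite ?h0 ?h1.
apply: rho_length_mono => t' /hg[//|[/only/[apply]]].
by case=> ->; exact: path_touched0.
Qed.

End Nonnegative.
End Potential.

(** * The bar *)

Section BarGeometry.
Context {R : realType} (D : dumbbell R).
Implicit Types (t u : tile) (p q : R * R).

Notation n := (bar_height D).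
Notation w := (bar_width D).

Definition in_bar t : bool :=
  [&& bar_x D <= t.1, t.1 < bar_x D + w%:Z,
      bar_y D <= t.2 & t.2 < bar_y D + n%:Z].

Lemma bar_sub : bar D `<=` D.
Proof. by move=> p pb; rewrite dumbbellE; left; right. Qed.

Lemma in_barP t : reflect (square t `<=` bar D) (in_bar t).
Proof.
apply: (iffP idP) => [|tb].
  rewrite /in_bar => /and4P[h1 h2 h3 h4] p /in_square[p1 p2].
  have {}h1 : (bar_x D)%:~R <= t.1%:~R :> R by rewrite ler_int.
  have {}h3 : (bar_y D)%:~R <= t.2%:~R :> R by rewrite ler_int.
  have {}h2 := @ltz_addr1 R _ _ h2; have {}h4 := @ltz_addr1 R _ _ h4.
  by rewrite /bar /rect /=; split; lra.
have := tb (t.1%:~R, t.2%:~R) ltac:(apply/in_square => /=; lra).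
have := tb (t.1%:~R + 1, t.2%:~R + 1) ltac:(apply/in_square => /=; lra).
rewrite /bar /rect /= -[1]/(1%:~R) -!intrD !ler_int /in_bar; clear; lia.
Qed.

Lemma in_bar_tile t : in_bar t -> tiles D t.
Proof. by move=> /in_barP tb p /tb; exact: bar_sub. Qed.

Lemma center_in_open_square t :
  let q : R * R := (t.1%:~R + 1 / 2, t.2%:~R + 1 / 2) in
  t.1%:~R < q.1 < t.1%:~R + 1 /\ t.2%:~R < q.2 < t.2%:~R + 1.
Proof. by rewrite /=; lra. Qed.

Lemma grid_interval_cell (x : int) (m : nat) (a : R) : (0 < m)%N ->
    x%:~R <= a <= (x + m%:Z)%:~R ->
  exists y : int, [/\ x <= y, y < x + m%:Z & y%:~R <= a <= y%:~R + 1].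
Proof.
(* At the right end of the interval the floor would name the cell just outside, so the last cell is
   taken. *)
move=> m0 /andP[xa ax]; have [aE|ne] := eqVneq a (x + m%:Z)%:~R.
  by exists (x + m%:Z - 1); split; [lia|lia|rewrite aE intrB; lra].
exists (Num.floor a); split.
- by rewrite floor_ge_int.
- by rewrite floor_lt_int lt_neqAle ne.
- by rewrite ge_floor -[X in _ + X]/(1%:~R) -intrD ltW // floorD1_gt.
Qed.

Lemma bar_subcomplex : subcomplex (bar D).
Proof.
exists [set c | c.2 = (true, true) /\ in_bar c.1].
apply/seteqP; split=> [p|p [[[x y] b] /= [-> /in_barP xyb]]]; last exact: xyb.
have w0 : (0 < w)%N by have := bar_elongated D; have := bar_height_gt0 D; lia.
move=> [/= p1 p2].
have [x [x1 x2 x3]] := grid_interval_cell w0 p1.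
have [y [y1 y2 y3]] := grid_interval_cell (bar_height_gt0 D) p2.
exists (x, y, (true, true)); first by split=> //; rewrite /in_bar /= x1 x2 y1 y2.
by rewrite /rect /= !intrD; split.
Qed.

(** The center of [u] lies in a ball or in the bar, and a subcomplex that contains the center of a
    tile contains the tile. *)
Lemma nonbar_tile_ball t u p : in_bar t -> tiles D u -> ~~ in_bar u ->
  square t p -> square u p -> (left_ball D `|` right_ball D) p.
Proof.
move=> tb Du nub tp up; have [q1 q2] := center_in_open_square u.
set q := (_, _) in q1 q2.
have uq : square u q by apply/in_square; split; lra.
have ballu X : subcomplex X -> X q -> tiles X u.
  by move=> sX Xq; exact: open_square_tile sX Xq q1 q2.
have := Du q uq; rewrite dumbbellE => -[[lq|bq]|rq].
- by left; apply: (ballu _ (left_ball_subcomplex D) lq).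
- by case/negP: nub; apply/in_barP; exact: (ballu _ bar_subcomplex bq).
- by right; apply: (ballu _ (right_ball_subcomplex D) rq).
Qed.

(** The chain runs along the row of [t] to the column of [u] and then along that column; it bounds
    skinny path distances inside the bar from above. *)
Lemma bar_chain t u : in_bar t -> in_bar u ->
  exists c, [/\ is_chain D t c, last t c = u &
                size c = (absz (u.1 - t.1)%R + absz (u.2 - t.2)%R)%N].
Proof.
have [m] := ubnP (absz (u.1 - t.1)%R + absz (u.2 - t.2)%R)%N.
elim: m t => // m IHm t /ltnSE tum tb ub.
have [tu|tu] := eqVneq t u.
  exists [::]; rewrite tu /= !subrr; split=> //; split=> // v.
  by rewrite inE => /eqP->; exact: in_bar_tile.
suff [t' [t'b t'tum [p tp t'p]]] : exists t', [/\ in_bar t',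
    (absz (u.1 - t'.1)%R + absz (u.2 - t'.2)%R).+1 =
    (absz (u.1 - t.1)%R + absz (u.2 - t.2)%R)%N &
    exists2 p : R * R, square t p & square t' p].
  have [|c [[cD cc] cu csz]] := IHm t' _ t'b ub.
    by move: tum; rewrite -t'tum.
  exists (t' :: c); split=> //=; last by rewrite csz.
  split=> [v|[_|i]] /=.
  - by rewrite in_cons => /orP[/eqP->|/cD//]; exact: in_bar_tile.
  - by exists p.
  - move=> ic; have := cc i ic.
    by rewrite (set_nth_default t) ?(set_nth_default t t') //= ltnS ltnW.
clear IHm tum.
have step (k l : int) : (absz k <= 1)%N -> (absz l <= 1)%N ->
    exists2 p : R * R, square t p & square (t.1 + k, t.2 + l) p.
  move=> k1 l1; exists (t.1%:~R + (Num.max 0 k)%:~R, t.2%:~R + (Num.max 0 l)%:~R).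
    have [? ?] : (0 <= Num.max 0 k <= 1) /\ (0 <= Num.max 0 l <= 1) by lia.
    apply/in_square; rewrite /= -!intrD -[X in _ <= _ + X]/(1%:~R).
    by rewrite -[in X in _ /\ X](_ : 1%:~R = 1) // -!intrD !ler_int; lia.
  have [? ?] : (k <= Num.max 0 k <= k + 1) /\ (l <= Num.max 0 l <= l + 1) by lia.
  apply/in_square; rewrite /= !intrD.
  by rewrite -[1]/(1%:~R) -!intrD !ler_int; lia.
have [lt1|lt1|e1] := ltgtP t.1 u.1.
- exists (t.1 + 1, t.2 + 0); split; last exact: step.
    by move: tb ub; rewrite /in_bar /=; clear -lt1; lia.
  by clear -lt1 => /=; lia.
- exists (t.1 - 1, t.2 + 0); split; last exact: step.
    by move: tb ub; rewrite /in_bar /=; clear -lt1; lia.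
  by clear -lt1 => /=; lia.
have [lt2|lt2|e2] := ltgtP t.2 u.2.
- exists (t.1 + 0, t.2 + 1); split; last exact: step.
    by move: tb ub; rewrite /in_bar /=; clear -lt2; lia.
  by clear -lt2 => /=; lia.
- exists (t.1 + 0, t.2 - 1); split; last exact: step.
    by move: tb ub; rewrite /in_bar /=; clear -lt2; lia.
  by clear -lt2 => /=; lia.
by case/eqP: tu; rewrite [t]surjective_pairing [u]surjective_pairing e1 e2.
Qed.

Lemma quad_adjacent_arcs (u v x : R) p : 0 <= u -> u <= v -> v <= x -> x < 1 ->
    (qloop D @` `[u, v]) p -> (qloop D @` `[v, x]) p ->
  p = qloop D v.
Proof.
move=> u0 uv vx x1 [s /= + <-] [s' /= + s'E]; rewrite !in_itv /= => s1 s2.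
have [_ _ ginj _ _] := qloop_clockwise D.
suff -> : s = v by [].
have : s = s' by apply: ginj => //; rewrite in_itv /=; lra.
lra.
Qed.

Lemma top_bottom_disjoint p : top_edge D p -> bottom_edge D p -> False.
Proof.
move=> [s /= + <-] [s' /= + s'E]; rewrite !in_itv /= => s1 s2.
have [b0 bc cd d1] := qloop_params D.
have [_ _ ginj _ _] := qloop_clockwise D.
have : s = s' by apply: ginj => //; rewrite in_itv /=; lra.
lra.
Qed.

Lemma left_top_edge p : left_edge D p -> top_edge D p -> p = qloop D 0.
Proof.
move=> [s /= + <-] [s' /= + s'E]; rewrite !in_itv /= => s1 s2.
have [b0 bc cd d1] := qloop_params D.
have [_ g01 ginj _ _] := qloop_clockwise D.
(* Parameter 1 is outside the range of injectivity; there the loop closes up at [qloop D 0]. *)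
have [->//|s_ne1] := eqVneq s 1.
have s_lt1 : s < 1 by rewrite lt_neqAle s_ne1; lra.
have : s = s' by apply: ginj => //; rewrite in_itv /=; lra.
by move=> ss'; exfalso; clear -ss' s1 s2 b0 bc cd; lra.
Qed.

Lemma left_bottom_edge p : left_edge D p -> bottom_edge D p -> p = qloop D (qd D).
Proof.
move=> [s /= + <-] [s' /= + s'E]; rewrite !in_itv /= => s1 s2.
have [b0 bc cd d1] := qloop_params D.
have [_ g01 ginj _ _] := qloop_clockwise D.
have [s_1|s_ne1] := eqVneq s 1.
  have s'0 : s' = 0; last by exfalso; clear -s'0 s2 b0 bc; lra.
  by apply: ginj; rewrite ?in_itv /=; [lra|lra|rewrite s'E s_1].
have s_lt1 : s < 1 by rewrite lt_neqAle s_ne1; lra.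
have ss' : s = s' by apply: ginj => //; rewrite in_itv /=; lra.
by congr qloop; lra.
Qed.

Lemma right_top_edge p : right_edge D p -> top_edge D p -> p = qloop D (qb D).
Proof.
have [b0 bc cd d1] := qloop_params D => rp tp.
by apply: (@quad_adjacent_arcs 0 _ (qc D)) tp rp; lra.
Qed.

Lemma right_bottom_edge p :
  right_edge D p -> bottom_edge D p -> p = qloop D (qc D).
Proof.
have [b0 bc cd d1] := qloop_params D.
by apply: quad_adjacent_arcs; lra.
Qed.

End BarGeometry.

(** * Rows, columns and sides of the bar *)

Section BarTiles.
Context {R : realType} (D : dumbbell R).
Implicit Types (t u : tile) (p q : R * R).

Notation n := (bar_height D).
Notation w := (bar_width D).
Notation balls := (left_ball D `|` right_ball D).

Lemma tile_eq t u : t.1 = u.1 -> t.2 = u.2 -> t = u.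
Proof. by case: t u => [? ?] [? ?] /= -> ->. Qed.

(** The two tiles share a side. Its midpoint has one half-integer coordinate, which determines the
    row or column, and so lies in no third tile. *)
Lemma side_midpoint t u p : square t p -> square u p ->
    (t.1 = u.1 /\ t.2 <> u.2) \/ (t.1 <> u.1 /\ t.2 = u.2) ->
  exists q, only_tiles D t u q.
Proof.
move=> /in_square[t1 t2] /in_square[u1 u2].
have half (x : int) : ~ gridval (x%:~R + 1 / 2 : R).
  by apply: (@not_gridval_between _ x); lra.
case=> -[e1 e2].
  exists (t.1%:~R + 1 / 2, p.2); split.
  - by apply/in_square => /=; lra.
  - by apply/in_square => /=; rewrite -e1; lra.
  move=> v _ /in_square[/= v1 v2].
  have {}v1 : v.1 = t.1 by apply: (grid_interval_eq (half t.1)) => //; lra.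
  have [v2'|v2'] := grid_interval_two e2 t2 u2 v2; [left|right];
    by apply: tile_eq; rewrite // v1.
exists (p.1, t.2%:~R + 1 / 2); split.
- by apply/in_square => /=; lra.
- by apply/in_square => /=; rewrite -e2; lra.
move=> v _ /in_square[/= v1 v2].
have {}v2 : v.2 = t.2 by apply: (grid_interval_eq (half t.2)) => //; lra.
have [v1'|v1'] := grid_interval_two e1 t1 u1 v1; [left|right];
  by apply: tile_eq; rewrite // v2.
Qed.

Definition row t : nat := absz (t.2 - bar_y D)%R.

Lemma row_lt t : in_bar D t -> (row t < n)%N.
Proof. by rewrite /in_bar /row; lia. Qed.

Definition bar_tile (k j : nat) : tile := (bar_x D + k%:Z, bar_y D + j%:Z).

Lemma bar_tile_in k j : (k < w)%N -> (j < n)%N -> in_bar D (bar_tile k j).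
Proof. by rewrite /in_bar /=; lia. Qed.

Lemma row_bar_tile k j : row (bar_tile k j) = j.
Proof. by rewrite /row /=; lia. Qed.

Lemma ball_bar_side p : balls p -> bar D p -> gridval p.1.
Proof.
move=> [lp|rp] bp.
  have [h _] := left_ball_bar (conj lp bp); exists (bar_x D).
  by move: h; rewrite addr0; lra.
have [h _] := right_ball_bar (conj rp bp); exists (bar_x D + w%:Z).
by move: h; rewrite addr0; lra.
Qed.

(** A tile outside the bar that contains [p] would put [p] in a ball, hence on a vertical side of
    the bar, where the first coordinate is an integer. *)
Lemma interior_column_tile t v p : in_bar D t -> square t p -> ~ gridval p.1 ->
  tiles D v -> square v p -> in_bar D v /\ v.1 = t.1.
Proof.
move=> tb tp p1 Dv vp; split; last first.
  have /in_square[v1 _] := vp; have /in_square[t1 _] := tp.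
  exact: grid_interval_eq p1 v1 t1.
apply: contrapT => /negP nvb; apply: p1; apply: ball_bar_side.
  exact: nonbar_tile_ball tb Dv nvb tp vp.
exact: (in_barP D t).
Qed.

Lemma sum_bar_tiles (F : tile -> R) :
  \sum_(t <- tile_seq D | in_bar D t) F t =
  \sum_(k < w) \sum_(j < n) F (bar_tile k j).
Proof.
rewrite -big_filter.
rewrite (perm_big [seq bar_tile k j | k <- iota 0 w, j <- iota 0 n]).
  have iotaE m : iota 0 m = index_iota 0 m by rewrite /index_iota subn0.
  rewrite big_allpairs_dep /= !iotaE big_mkord; apply: eq_bigr => k _.
  by rewrite big_mkord.
apply: uniq_perm.
- by rewrite filter_uniq // tile_seq_uniq.
- apply: allpairs_uniq; rewrite ?iota_uniq // => -[k j] [k' j'] _ _ /= [].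
  by move=> /addrI[->] /addrI[->].
- move=> t; rewrite mem_filter mem_tile_seq; apply/andP/allpairsP.
    move=> [tb _]; exists (absz (t.1 - bar_x D)%R, row t).
    have /and4P[h1 h2 h3 h4] := tb; rewrite !mem_iota /row; split=> /=.
    + by clear -h1 h2; lia.
    + by clear -h3 h4; lia.
    + by apply: tile_eq => /=; [clear -h1 h2; lia|clear -h3 h4; lia].
  move=> [[k j] /= [+ + ->]]; rewrite !mem_iota /= => kw jn.
  have tb := bar_tile_in kw jn; split=> //; apply/asboolP; exact: in_bar_tile.
Qed.

End BarTiles.

(** * Levels in a column of the bar *)

Section BarLevels.
Context {R : realType} (D : dumbbell R).
Implicit Types (t u : tile) (p q : R * R).

Notation n := (bar_height D).
Notation w := (bar_width D).

Variable rho : tile -> R.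
Hypothesis rho_ge0 : forall t, tiles D t -> 0 <= rho t.

Notation H := (rho_height D rho).
Notation row := (row D).
Notation bar_tile := (bar_tile D).

Lemma lower_le_upper t : tiles D t -> lower_level D rho t <= upper_level D rho t.
Proof. by move=> /rho_ge0; rewrite /lower_level; lra. Qed.

(** The midpoint of the bottom side of the tile lies on the bottom edge and in no other tile of
    [D]. *)
Lemma bottom_row_lower k : (k < w)%N -> lower_level D rho (bar_tile k 0) <= 0.
Proof.
move=> kw; have tb := bar_tile_in kw (bar_height_gt0 D).
pose p : R * R := ((bar_tile k 0).1%:~R + 1 / 2, (bar_y D)%:~R).
have tp : square (bar_tile k 0) p.
  by apply/in_square; rewrite /p /= addr0; lra.
have p1 : ~ gridval p.1.
  by apply: (@not_gridval_between _ (bar_tile k 0).1); rewrite /p /=; lra.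
apply: (lower_level_bottom rho_ge0 (in_bar_tile tb) (p := p)).
  split=> // v Dv vp; have [vb v1] := interior_column_tile tb tp p1 Dv vp.
  left; apply: tile_eq => //; apply/eqP; rewrite eq_le; apply/andP; split.
    rewrite -(ler_int R); have /in_square[_] := vp; rewrite /p /= addr0; lra.
  by move: vb; rewrite /in_bar /= addr0 => /and4P[].
apply: bar_bottom_edge; rewrite /bar_bottom /rect /p /= !addr0 lexx; split=> //.
have := kw; rewrite -(ltr_nat R) !intrD => kw'.
have : (k%:R + 1 : R) <= w%:R by rewrite natr1 ler_nat.
have : (0 : R) <= k%:R by [].
rewrite -!pmulrn; lra.
Qed.

Lemma top_row_upper k : (k < w)%N -> H <= upper_level D rho (bar_tile k n.-1).
Proof.
move=> kw; have n0 := bar_height_gt0 D.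
have tb : in_bar D (bar_tile k n.-1) by apply: bar_tile_in => //; rewrite prednK.
pose p : R * R := ((bar_tile k n.-1).1%:~R + 1 / 2, (bar_y D + n%:Z)%:~R).
have t2 : (bar_tile k n.-1).2 + 1 = bar_y D + n%:Z by rewrite /=; clear -n0; lia.
have t2R : (bar_tile k n.-1).2%:~R + 1 = (bar_y D + n%:Z)%:~R :> R.
  by rewrite -t2 intrD.
have p2 : p.2 = (bar_tile k n.-1).2%:~R + 1 by rewrite t2R.
have tp : square (bar_tile k n.-1) p.
  by apply/in_square; rewrite p2 /=; lra.
have p1 : ~ gridval p.1.
  by apply: (@not_gridval_between _ (bar_tile k n.-1).1); rewrite /p /=; lra.
apply: (upper_level_top rho_ge0 (in_bar_tile tb) (p := p)).
  split=> // v Dv vp; have [vb v1] := interior_column_tile tb tp p1 Dv vp.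
  left; apply: tile_eq => //; apply/eqP; rewrite eq_le; apply/andP; split.
    by rewrite -(lerD2r 1) t2 lezD1; case/and4P: vb.
  rewrite -(ler_int R); have /in_square[_] := vp.
  by rewrite p2; lra.
apply: bar_top_edge; rewrite /bar_top /rect /p /= !addr0 lexx; split=> //.
have := kw; rewrite -(ltr_nat R) !intrD => kw'.
have : (k%:R + 1 : R) <= w%:R by rewrite natr1 ler_nat.
have : (0 : R) <= k%:R by [].
rewrite -!pmulrn; lra.
Qed.

Lemma column_chain k j : (k < w)%N -> (j.+1 < n)%N ->
  lower_level D rho (bar_tile k j.+1) <= upper_level D rho (bar_tile k j).
Proof.
move=> kw jn; have tb := bar_tile_in kw (ltnW jn); have ub := bar_tile_in kw jn.
have [q only] : exists q, only_tiles D (bar_tile k j) (bar_tile k j.+1) q.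
  apply: (@side_midpoint _ _ _ _
    ((bar_tile k j).1%:~R, (bar_tile k j.+1).2%:~R)).
  - apply/in_square; split; first by rewrite /=; lra.
    by rewrite /= !intrD -!pmulrn -natr1; lra.
  - by apply/in_square => /=; lra.
  - by left; split => //=; clear; lia.
exact: (lower_upper_level rho_ge0 (in_bar_tile tb) (in_bar_tile ub) only).
Qed.

End BarLevels.

(** * Columns near and far from the fixed tile *)

Section FarTile.
Context {R : realType} (D : dumbbell R).
Implicit Types (t u : tile) (p q : R * R).

Notation n := (bar_height D).
Notation w := (bar_width D).
Notation balls := (left_ball D `|` right_ball D).

Variable t0 : tile.
Hypothesis t0_bar : in_bar D t0.
Hypothesis t0_far :
  ((3 * n)%:R%:E <= skinny_path_distance D (square t0) balls)%E.

Definition column_distance t : nat := absz (t.1 - t0.1)%R.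

(** A chain from [t0] to a ball makes at least [3 * n] steps, while the chain of [bar_chain] makes
    fewer than [n] vertical ones. *)
Lemma ball_column_distance t p : in_bar D t -> square t p -> balls p ->
  (n <= column_distance t)%N.
Proof.
move=> tb tp Bp; have [c [cc cl csz]] := bar_chain t0_bar tb.
have : ((3 * n)%:R%:E <= ((size c)%:R : R)%:E)%E.
  apply: le_trans t0_far _; apply: ereal_inf_lbound; exists (t0, c) => //=.
  split=> //=; last by rewrite cl; exists p.
  by exists (t0.1%:~R, t0.2%:~R); split; apply/in_square => /=; lra.
rewrite lee_fin ler_nat csz /column_distance.
move: t0_bar tb; rewrite /in_bar; clear; lia.
Qed.

(** Here [E] is the top or bottom edge of the quadrilateral. If the left ball were empty, the left
    side of the bar would be the left edge, which meets [E] only at the vertex [c], and [p] is no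
    vertex. So the ball is nonempty and meets a tile in the column of [t]. *)
Lemma left_side_column_distance t p (E : set (R * R)) (c : R * R) (y : int) :
    in_bar D t -> square t p -> p.1 = (bar_x D)%:~R -> E p ->
    ~ (gridval p.1 /\ gridval p.2) ->
    (forall q, left_edge D q -> E q -> q = c) ->
    E ((bar_x D)%:~R, y%:~R) -> bar_left D ((bar_x D)%:~R, y%:~R) ->
  (n <= column_distance t)%N.
Proof.
move=> tb tp p1 Ep pZ Ec Ey yb.
have pl : bar_left D p.
  have [_ h] := (in_barP D t) tb p tp; split=> //.
  by rewrite p1 addr0 lexx.
have [L0|/nonemptyPn L0] := pselect (left_ball D !=set0); last first.
  have lE := left_ball_empty L0; exfalso; apply: pZ.
  rewrite (Ec p) ?lE // -(Ec ((bar_x D)%:~R, y%:~R)) ?lE //=.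
  by split; [exists (bar_x D)|exists y].
have [z [Lz zb]] := left_ball_bar_neq0 L0.
have [z1 z2] := left_ball_bar (conj Lz zb).
have [y' [y'1 y'2 y'z]] := grid_interval_cell (bar_height_gt0 D) z2.
apply: (@ball_column_distance (t.1, y') z); last by left.
- by move: tb; rewrite /in_bar /= y'1 y'2 => /and4P[-> -> _ _].
- apply/in_square; split=> //=; move: z1; rewrite /= addr0 => z1.
  have /in_square[p1' _] := tp; have : (bar_x D)%:~R <= t.1%:~R :> R.
    by rewrite ler_int; case/and4P: tb.
  by rewrite p1 in p1'; lra.
Qed.

Lemma right_side_column_distance t p (E : set (R * R)) (c : R * R) (y : int) :
    in_bar D t -> square t p -> p.1 = (bar_x D + w%:Z)%:~R -> E p ->
    ~ (gridval p.1 /\ gridval p.2) ->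
    (forall q, right_edge D q -> E q -> q = c) ->
    E ((bar_x D + w%:Z)%:~R, y%:~R) ->
    bar_right D ((bar_x D + w%:Z)%:~R, y%:~R) ->
  (n <= column_distance t)%N.
Proof.
move=> tb tp p1 Ep pZ Ec Ey yb.
have pl : bar_right D p.
  have [_ h] := (in_barP D t) tb p tp; split=> //.
  by rewrite p1 addr0 lexx.
have [L0|/nonemptyPn L0] := pselect (right_ball D !=set0); last first.
  have lE := right_ball_empty L0; exfalso; apply: pZ.
  rewrite (Ec p) ?lE // -(Ec ((bar_x D + w%:Z)%:~R, y%:~R)) ?lE //=.
  by split; [exists (bar_x D + w%:Z)|exists y].
have [z [Lz zb]] := right_ball_bar_neq0 L0.
have [z1 z2] := right_ball_bar (conj Lz zb).
have [y' [y'1 y'2 y'z]] := grid_interval_cell (bar_height_gt0 D) z2.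
apply: (@ball_column_distance (t.1, y') z); last by right.
- by move: tb; rewrite /in_bar /= y'1 y'2 => /and4P[-> -> _ _].
- apply/in_square; split=> //=; move: z1; rewrite /= addr0 => z1.
  have /in_square[p1' _] := tp; have : t.1%:~R + 1 <= (bar_x D + w%:Z)%:~R :> R.
    by apply: ltz_addr1; case/and4P: tb.
  by rewrite p1 in p1'; lra.
Qed.

Lemma bar_frontier p : bar D p -> frontier D p ->
  [\/ p.1 = (bar_x D)%:~R, p.1 = (bar_x D + w%:Z)%:~R, bar_bottom D p |
      bar_top D p].
Proof.
move=> pb [_ pI]; have [/andP[p1 p2] /andP[p3 p4]] := pb.
have [->|n1] := eqVneq p.1 (bar_x D)%:~R; first exact: Or41.
have [->|n2] := eqVneq p.1 (bar_x D + w%:Z)%:~R; first exact: Or42.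
have [e3|n3] := eqVneq p.2 (bar_y D)%:~R.
  by apply: Or43; split; rewrite ?p1 // e3 addr0 lexx.
have [e4|n4] := eqVneq p.2 (bar_y D + n%:Z)%:~R.
  by apply: Or44; split; rewrite ?p1 // e4 addr0 lexx.
exfalso; apply: pI; apply: (rect_interior (@bar_sub _ D)).
  by rewrite !lt_neqAle p1 p2 n2 eq_sym n1.
by rewrite !lt_neqAle p3 p4 n4 eq_sym n3.
Qed.

(** Besides the bottom side of the bar, the bottom edge may run along part of a vertical side; the
    second alternative covers that case. *)
Lemma bottom_edge_tile t p : in_bar D t -> square t p -> bottom_edge D p ->
    ~ (gridval p.1 /\ gridval p.2) ->
  t.2 = bar_y D \/ (n <= column_distance t)%N.
Proof.
move=> tb tp bp pZ; have pb := (in_barP D t) tb p tp.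
have [p1|p1|p2|p2] := bar_frontier pb (bottom_edge_frontier bp).
- right; apply: (left_side_column_distance (y := bar_y D) tb tp p1 bp pZ).
  + exact: left_bottom_edge.
  + apply: bar_bottom_edge; rewrite /bar_bottom /rect /= !addr0 !lexx /=.
    by rewrite ler_int lerDl.
  + by rewrite /bar_left /rect /= !addr0 !lexx !ler_int lerDl.
- right; apply: (right_side_column_distance (y := bar_y D) tb tp p1 bp pZ).
  + exact: right_bottom_edge.
  + apply: bar_bottom_edge; rewrite /bar_bottom /rect /= !addr0 !lexx /=.
    by rewrite ler_int lerDl.
  + by rewrite /bar_right /rect /= !addr0 !lexx !ler_int lerDl.
- left; have [_ h] := p2; have /in_square[_ h'] := tp.
  apply/eqP; rewrite eq_le; case/and4P: tb => _ _ -> _; rewrite andbT.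
  by rewrite -(ler_int R); move: h; rewrite addr0; lra.
- by case: (top_bottom_disjoint (bar_top_edge p2) bp).
Qed.

Lemma top_edge_tile t p : in_bar D t -> square t p -> top_edge D p ->
    ~ (gridval p.1 /\ gridval p.2) ->
  t.2 + 1 = bar_y D + n%:Z \/ (n <= column_distance t)%N.
Proof.
move=> tb tp bp pZ; have pb := (in_barP D t) tb p tp.
have [p1|p1|p2|p2] := bar_frontier pb (top_edge_frontier bp).
- right; apply: (left_side_column_distance (y := bar_y D + n%:Z) tb tp p1 bp pZ).
  + exact: left_top_edge.
  + apply: bar_top_edge; rewrite /bar_top /rect /= !addr0 !lexx /=.
    by rewrite ler_int lerDl.
  + by rewrite /bar_left /rect /= !addr0 !lexx !ler_int lerDl.
- right; apply: (right_side_column_distance (y := bar_y D + n%:Z) tb tp p1 bp pZ).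
  + exact: right_top_edge.
  + apply: bar_top_edge; rewrite /bar_top /rect /= !addr0 !lexx /=.
    by rewrite ler_int lerDl.
  + by rewrite /bar_right /rect /= !addr0 !lexx !ler_int lerDl.
- by case: (top_bottom_disjoint bp (bar_bottom_edge p2)).
- left; have [_ h] := p2; have /in_square[_ h'] := tp.
  apply/eqP; rewrite eq_le; have /and4P[_ _ _ h''] := tb.
  rewrite (_ : t.2 + 1 <= _); last by rewrite lezD1.
  by rewrite -(ler_int R) [(t.2 + 1)%:~R]intrD; move: h; rewrite addr0; lra.
Qed.

End FarTile.

(** * Clamping the levels *)

Section Barriers.

(* Barriers in a column at distance [s] from the distinguished one, at the
   horizontal edge [j] counted from the bottom, in units of [H / n]. *)
Definition up_barrier (n s j : nat) : nat :=
  if j is 0%N then 0%N else minn (j + s)%N n.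

(** Truncated subtraction is the cut-off at 0. The value at the top edge is [n] in every column,
    just as [up_barrier] is 0 at the bottom edge. *)
Definition low_barrier (n s j : nat) : nat := if (n <= j)%N then n else (j - s)%N.

(** Serves both for consecutive edges of one column and for tiles sharing a side, where row and
    column distance do not change together. *)
Lemma up_barrier_step (n s s' j j' : nat) :
    (j' <= j.+1)%N -> (j' + s' <= j.+1 + s)%N ->
  (up_barrier n s' j' <= up_barrier n s j.+1)%N.
Proof. by case: j' => [|j'] //=; lia. Qed.

Lemma low_barrier_step (n s s' j j' : nat) :
    (j' <= j.+1)%N -> (j' + s <= j.+1 + s')%N -> (j' < n)%N ->
  (low_barrier n s' j' <= low_barrier n s j.+1)%N.
Proof. by rewrite /low_barrier; do 2 case: ifP; lia. Qed.

Lemma up_barrier_mono n s j : (up_barrier n s j <= up_barrier n s j.+1)%N.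
Proof. by apply: up_barrier_step; lia. Qed.

Lemma low_barrier_mono n s j :
  (j < n)%N -> (low_barrier n s j <= low_barrier n s j.+1)%N.
Proof. by move=> jn; apply: low_barrier_step; lia. Qed.

Lemma up_barrier_concave n s j : (j.+1 < n)%N ->
  (up_barrier n s j.+2 + up_barrier n s j <=
   up_barrier n s j.+1 + up_barrier n s j.+1)%N.
Proof. by case: j => [|j] /=; lia. Qed.

Lemma low_barrier_convex n s j : (j.+1 < n)%N ->
  (low_barrier n s j.+1 + low_barrier n s j.+1 <=
   low_barrier n s j.+2 + low_barrier n s j)%N.
Proof. by rewrite /low_barrier; do 3 case: ifP; lia. Qed.

Lemma up_barrier_full n s j : (n <= j.+1 + s)%N -> up_barrier n s j.+1 = n.
Proof. by rewrite /=; lia. Qed.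

Lemma low_barrier_0 n s j : (j < n)%N -> (j <= s)%N -> low_barrier n s j = 0%N.
Proof. by rewrite /low_barrier; case: ifP; lia. Qed.

Lemma up_barrier0 n j : (j <= n)%N -> up_barrier n 0 j = j.
Proof. by case: j => //= j; lia. Qed.

Lemma low_barrier0 n j : (j <= n)%N -> low_barrier n 0 j = j.
Proof. by rewrite /low_barrier; case: ifP; lia. Qed.

End Barriers.

(** * The flattened weight, its height and its area *)

Section FlattenedWeight.
Context {R : realType} (D : dumbbell R).
Implicit Types (t u : tile) (p q : R * R) (g : R -> R * R).

Notation n := (bar_height D).
Notation w := (bar_width D).
Notation balls := (left_ball D `|` right_ball D).

Variable rho : tile -> R.
Hypothesis rho_ge0 : forall t, tiles D t -> 0 <= rho t.
Variable t0 : tile.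
Hypothesis t0_bar : in_bar D t0.
Hypothesis t0_far :
  ((3 * n)%:R%:E <= skinny_path_distance D (square t0) balls)%E.

Notation H := (rho_height D rho).
Notation row := (row D).
Notation bar_tile := (bar_tile D).
Notation s_ := (column_distance t0).

Definition level (k : nat) : R := H / n%:R * k%:R.

Lemma rho_height_ge0 : 0 <= H.
Proof. by apply: rho_height_ge => g _; exact: rho_length_ge0. Qed.

Lemma level_le k l : (k <= l)%N -> level k <= level l.
Proof.
by move=> kl; rewrite ler_wpM2l ?ler_nat // divr_ge0 ?rho_height_ge0.
Qed.

Lemma level0 : level 0 = 0.
Proof. by rewrite /level mulr0. Qed.

Lemma level_full : level n = H.
Proof. by rewrite /level divfK // pnatr_eq0 -lt0n; exact: bar_height_gt0. Qed.

(** A tile in row [j] lies between the horizontal edges [j] and [j.+1]: its lower level is clamped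
    by the barriers at [j], its upper level by those at [j.+1]. *)
Definition flat_lower t : R :=
  if in_bar D t then
    Num.max (Num.min (lower_level D rho t) (level (up_barrier n (s_ t) (row t))))
            (level (low_barrier n (s_ t) (row t)))
  else lower_level D rho t.

Definition flat_upper t : R :=
  if in_bar D t then
    Num.max (Num.min (upper_level D rho t) (level (up_barrier n (s_ t) (row t).+1)))
            (level (low_barrier n (s_ t) (row t).+1))
  else upper_level D rho t.

Definition flat_weight t : R := flat_upper t - flat_lower t.

Lemma flat_weight_ge0 t : tiles D t -> 0 <= flat_weight t.
Proof.
move=> Dt; rewrite subr_ge0 /flat_lower /flat_upper; case: ifP => [tb|_].
  apply: le_min_max; first exact: lower_le_upper.
    exact/level_le/up_barrier_mono.
  exact/level_le/low_barrier_mono/row_lt.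
exact: lower_le_upper.
Qed.

(** The tile in the column of [t] and the row of [u] is in the bar and contains [p], so it is [t] or
    [u]. Hence the two tiles share a row or a column. *)
Lemma bar_neighbours t u p : in_bar D t -> in_bar D u -> only_tiles D t u p ->
  [/\ (row u <= (row t).+1)%N, (row u + s_ u <= (row t).+1 + s_ t)%N
    & (row u + s_ t <= (row t).+1 + s_ u)%N].
Proof.
move=> tb ub [/[dup] tp /in_square[t1 t2] /[dup] up /in_square[u1 u2] only].
have near (x y : int) (a : R) : x%:~R <= a <= x%:~R + 1 ->
    y%:~R <= a <= y%:~R + 1 -> x <= y + 1.
  by move=> xa ya; rewrite -(ler_int R) intrD; lra.
have [c1 c2 c3 c4] : [/\ t.1 <= u.1 + 1, u.1 <= t.1 + 1, t.2 <= u.2 + 1 &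
    u.2 <= t.2 + 1].
  by split; [exact: near t1 u1|exact: near u1 t1|exact: near t2 u2|
             exact: near u2 t2].
have vb : in_bar D (t.1, u.2).
  by move: tb ub => /and4P[h1 h2 _ _] /and4P[_ _ h3 h4]; exact/and4P.
have vp : square (t.1, u.2) p by apply/in_square.
have : t.1 = u.1 \/ t.2 = u.2.
  have [e|e] := only _ (in_bar_tile vb) vp; first by right; rewrite -e.
  by left; rewrite -e.
move: tb ub c1 c2 c3 c4; rewrite /in_bar /row /column_distance; clear.
by move=> h1 h2 h3 h4 h5 h6 h7; split; lia.
Qed.

(** Inside the bar the barriers of the two tiles are compatible. Where the bar meets a ball, the
    column is at distance at least [n], so the relevant barrier is [H] or 0 and clamping cannot
    cross [c]. *)
Lemma flat_level_connected t u p (c : R) : tiles D t -> tiles D u ->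
    only_tiles D t u p -> 0 < c <= H -> flat_upper t < c -> c <= flat_lower u ->
  False.
Proof.
move=> Dt Du only /andP[c0 cH].
have ab := lower_upper_level rho_ge0 Dt Du only.
have [tp up _] := only; rewrite /flat_upper /flat_lower.
case: ifP => tb; case: ifP => ub tc cu.
- have [h1 h2 h3] := bar_neighbours tb ub only.
  have := lt_le_trans tc cu; rewrite ltNge le_min_max //; apply: level_le.
    exact: up_barrier_step.
  by apply: low_barrier_step => //; exact: row_lt.
- have := ball_column_distance t0_bar t0_far tb tp
    (nonbar_tile_ball tb Du (negbT ub) tp up).
  move=> sn; move: tc; rewrite up_barrier_full ?level_full; last first.
    by rewrite (leq_trans sn) // leq_addl.
  rewrite gt_max gt_min => /andP[/orP[tc|Hc] _]; lra.
- have := ball_column_distance t0_bar t0_far ub up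
    (nonbar_tile_ball ub Dt (negbT tb) up tp).
  have := row_lt ub => rn sn; move: cu; rewrite low_barrier_0 //; last first.
    exact: leq_trans (ltnW rn) sn.
  rewrite level0 le_max le_min => /orP[/andP[cu _]|cu]; lra.
- by have := lt_le_trans tc cu; rewrite ltNge ab.
Qed.

(** Sliding [p] along the bottom edge gives a point that lies in one tile only, and this tile
    contains [p] too. The lower barrier vanishes there, as the tile is in the bottom row or in a far
    column. *)
Lemma flat_lower_bottom p : bottom_edge D p ->
  exists t, [/\ tiles D t, square t p & flat_lower t <= 0].
Proof.
move=> [s /= + <-]; rewrite in_itv /= => s_cd.
have [b0 bc cd d1] := qloop_params D.
have [s' [t [[s'_cd Dt ts ts' nv] only]]] := frontier_arc_tile (qdisk_disk D)
  (dumbbell_subcomplex D) (qloop_clockwise D) (ltW (lt_trans b0 bc)) cd d1 s_cd.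
have be : bottom_edge D (qloop D s') by exists s'.
have a0 : lower_level D rho t <= 0.
  apply: (lower_level_bottom rho_ge0 Dt _ be); split=> // t' Dt' tt'.
  by left; exact: only.
exists t; split=> //; rewrite /flat_lower; case: ifP => // tb.
rewrite low_barrier_0 ?row_lt //; last first.
  have [t2|sn] := bottom_edge_tile t0_bar t0_far tb ts' be nv.
    by rewrite /row t2 subrr.
  exact: leq_trans (ltnW (row_lt tb)) sn.
by rewrite level0 ge_max lexx andbT ge_min a0.
Qed.

Lemma flat_upper_top p : top_edge D p ->
  exists t, [/\ tiles D t, square t p & H <= flat_upper t].
Proof.
move=> [s /= + <-]; rewrite in_itv /= => s_0b.
have [b0 bc cd d1] := qloop_params D.
have [s' [t [[s'_0b Dt ts ts' nv] only]]] := frontier_arc_tile (qdisk_disk D)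
  (dumbbell_subcomplex D) (qloop_clockwise D) (lexx 0) b0
  (lt_trans bc (lt_trans cd d1)) s_0b.
have te : top_edge D (qloop D s') by exists s'.
have bH : H <= upper_level D rho t.
  apply: (upper_level_top rho_ge0 Dt _ te); split=> // t' Dt' tt'.
  by left; exact: only.
exists t; split=> //; rewrite /flat_upper; case: ifP => // tb.
rewrite up_barrier_full; last first.
  have [t2|sn] := top_edge_tile t0_bar t0_far tb ts' te nv.
    rewrite (_ : (row t).+1 = n) ?leq_addr //.
    by move: tb t2; rewrite /row /in_bar; clear; lia.
  by rewrite (leq_trans sn) // leq_addl.
by rewrite level_full le_max le_min bH lexx.
Qed.

(** Otherwise every touched tile is entirely below or entirely above [c]. The closed unions [Lo] and
    [Up] then split the connected image of [g] into two disjoint nonempty parts. *)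
Lemma flat_level_touched g (c : R) : joins_top_bottom D g -> 0 < c <= H ->
  exists2 t, touched D g t & flat_lower t < c <= flat_upper t.
Proof.
move=> [cg gD gtop gbot] c0H; apply: contrapT => nt.
have side t : touched D g t -> flat_upper t < c \/ c <= flat_lower t.
  move=> gt; have [|h1] := ltP (flat_upper t) c; first by left.
  have [|h2] := leP c (flat_lower t); first by right.
  by exfalso; apply: nt; exists t => //; rewrite h2 h1.
pose I := g @` `[0, 1]; pose below := tiles D `&` [set t | flat_upper t < c].
pose above := tiles D `&` [set t | c <= flat_lower t].
pose Lo := \bigcup_(t in below) (square t : set (R * R)).
pose Up := \bigcup_(t in above) (square t : set (R * R)).
have finD := tiles_finite (qdisk_disk D).
have cLo : closed Lo.
  by apply: squares_closed; apply: sub_finite_set finD => t [].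
have cUp : closed Up.
  by apply: squares_closed; apply: sub_finite_set finD => t [].
have touch t (p : R * R) : tiles D t -> square t p -> I p -> touched D g t.
  by move=> Dt tp Ip; split=> //; exists p.
have cover p : I p -> Lo p \/ Up p.
  move=> Ip; have [t Dt tp] :=
    planar_disk_tile (qdisk_disk D) (dumbbell_subcomplex D) (gD p Ip).
  by case: (side t (touch t p Dt tp Ip)) => h; [left|right]; exists t.
have same t : tiles D t -> flat_upper t < c -> c <= flat_lower t -> False.
  by move=> Dt tc ct; have := flat_weight_ge0 Dt; rewrite /flat_weight; lra.
have side_adj t u p : tiles D t -> tiles D u -> square t p -> square u p ->
    t.1 = u.1 \/ t.2 = u.2 -> flat_upper t < c -> c <= flat_lower u -> False.
  move=> Dt Du tp up tu tc uc; have [tu'|tu'] := pselect (t = u).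
    by apply: (same t) => //; rewrite tu'.
  have [q only] : exists q, only_tiles D t u q.
    by apply: (side_midpoint D tp up); case: tu => e; [left|right]; split=> // e';
      apply: tu'; exact: tile_eq.
  exact: (flat_level_connected Dt Du only c0H).
(* Only tiles meeting at a corner remain. A third tile at that corner shares a side with each of
   them and is itself below or above [c]; with no third tile, a path can cross at the corner
   directly. *)
have disj p : I p -> Lo p -> Up p -> False.
  move=> Ip [t [Dt /= tc] tp] [u [Du /= uc] up].
  have [tu|/not_orP[tu1 tu2]] := pselect (t.1 = u.1 \/ t.2 = u.2).
    exact: (side_adj t u p).
  have [[v [Dv vp vt vu]]|nv] :=
      pselect (exists v, [/\ tiles D v, square v p, v <> t & v <> u]); last first.
    apply: (flat_level_connected Dt Du _ c0H tc uc (p := p)); split=> // v Dv vp.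
    apply: contrapT => /not_orP[vt vu]; apply: nv; exists v; split=> //.
  have /in_square[t1 t2] := tp; have /in_square[u1 u2] := up.
  have /in_square[v1 v2] := vp.
  have vt' : v.1 = t.1 \/ v.2 = t.2.
    have [->|e1] := grid_interval_two tu1 t1 u1 v1; first by left.
    have [->|e2] := grid_interval_two tu2 t2 u2 v2; first by right.
    by case: vu; exact: tile_eq.
  have vu' : v.1 = u.1 \/ v.2 = u.2.
    have [e1|->] := grid_interval_two tu1 t1 u1 v1; last by left.
    have [e2|->] := grid_interval_two tu2 t2 u2 v2; last by right.
    by case: vt; exact: tile_eq.
  have [vc|vc] := side v (touch v p Dv vp Ip).
    exact: (side_adj v u p).
  apply: (side_adj t v p) => //.
  by case: vt' => ->; [left|right].
have Icon : connected I.
  by apply: connected_continuous_connected cg; exact: segment_connected.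
have I0 : I (g 0) by exists 0 => //=; rewrite in_itv /= lexx ler01.
have I1 : I (g 1) by exists 1 => //=; rewrite in_itv /= lexx ler01.
have Up0 : Up (g 0).
  have [t [Dt tp tH]] := flat_upper_top gtop; exists t => //; split=> //=.
  have [|//] := side t (touch t _ Dt tp I0).
  by case/andP: c0H; lra.
have Lo1 : Lo (g 1).
  have [t [Dt tp tH]] := flat_lower_bottom gbot; exists t => //; split=> //=.
  have [//|] := side t (touch t _ Dt tp I1).
  by case/andP: c0H; lra.
have : I `&` Lo = I.
  apply: Icon; first by exists (g 1).
    exists (~` Up); first exact: closed_openC.
    apply/seteqP; split=> p [Ip h]; split=> //.
      by move=> /(disj p Ip h).
    by case: (cover p Ip).
  by exists Lo.
by move=> E; have [_ Lo0] : (I `&` Lo) (g 0) by [rewrite E]; exact: (disj (g 0)).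
Qed.

Lemma flat_height g : joins_top_bottom D g -> H <= rho_length D flat_weight g.
Proof.
move=> jg; rewrite rho_lengthE -big_filter -[leLHS]subr0.
apply: interval_cover => [t|c c0H].
  rewrite mem_filter mem_tile_seq => /andP[_ /asboolP Dt].
  by rewrite -subr_ge0; exact: flat_weight_ge0.
have [t gt tc] := flat_level_touched jg c0H; exists t => //.
by rewrite mem_filter mem_tile_seq; apply/andP; split; apply/asboolP => //; case: gt.
Qed.

Lemma levelD k l : level (k + l) = level k + level l.
Proof. by rewrite /level natrD mulrDr. Qed.

(** At distance 0 both barriers are the linear profile, so clamping leaves one unit of [H / n] per
    row. *)
Lemma flat_weight_t0 : flat_weight t0 = n%:R^-1 * H.
Proof.
have rt := row_lt t0_bar.
have minmax (x y : R) : Num.max (Num.min x y) y = y.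
  by apply: max_r; rewrite ge_min lexx orbT.
rewrite /flat_weight /flat_upper /flat_lower t0_bar /column_distance subrr.
rewrite !up_barrier0 ?(ltnW rt) // !low_barrier0 ?(ltnW rt) // !minmax.
by rewrite -[(row t0).+1]addn1 levelD addrAC subrr add0r /level mulr1 mulrC.
Qed.

Lemma column_energy k : (k < w)%N ->
  \sum_(j < n) flat_weight (bar_tile k j) ^+ 2 <=
  \sum_(j < n) rho (bar_tile k j) ^+ 2.
Proof.
move=> kw; have n0 := bar_height_gt0 D.
pose s := s_ (bar_tile k 0).
pose a j := lower_level D rho (bar_tile k j).
pose b j := upper_level D rho (bar_tile k j).
pose B j := level (up_barrier n s j); pose C j := level (low_barrier n s j).
have ab j : (j < n)%N -> a j <= b j.
  by move=> jn; apply/lower_le_upper/in_bar_tile/bar_tile_in.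
have chain j : (j.+1 < n)%N -> a j.+1 <= b j by exact: column_chain.
have Bmono j : B j <= B j.+1 by exact/level_le/up_barrier_mono.
have -> : \sum_(j < n) flat_weight (bar_tile k j) ^+ 2 =
    \sum_(j < n) (Num.max (Num.min (b j) (B j.+1)) (C j.+1) -
                  Num.max (Num.min (a j) (B j)) (C j)) ^+ 2.
  apply: eq_bigr => j _; rewrite /flat_weight /flat_upper /flat_lower.
  by rewrite bar_tile_in // row_bar_tile.
have -> : \sum_(j < n) rho (bar_tile k j) ^+ 2 = \sum_(j < n) (b j - a j) ^+ 2.
  by apply: eq_bigr => j _; rewrite /b /a /lower_level opprB addrC subrK.
(* The cap by [B] is applied first; the capped levels still form a chain, to which the convex
   barrier [C] applies. *)
apply: (@le_trans _ _
  (\sum_(j < n) (Num.min (b j) (B j.+1) - Num.min (a j) (B j)) ^+ 2)).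
  apply: (@energy_join_convex R n (fun j => Num.min (a j) (B j))
    (fun j => Num.min (b j) (B j.+1)) C).
  - rewrite /C /low_barrier leqnn /B prednK // -{4}(prednK n0) up_barrier_full.
      by rewrite level_full le_min lexx andbT; exact: top_row_upper.
    by rewrite prednK // leq_addr.
  - by move=> j jn; rewrite le_min !ge_min ab //= Bmono orbT.
  - by move=> j jn; rewrite le_min !ge_min chain //= lexx orbT.
  - by move=> j jn; apply/level_le/low_barrier_mono.
  - move=> j jn; have := level_le (low_barrier_convex s jn).
    by rewrite !levelD /C; lra.
apply: energy_meet_concave => //.
- by rewrite /B /= level0; exact: bottom_row_lower.
- move=> j jn; have := level_le (up_barrier_concave s jn).
  by rewrite !levelD /B; lra.
Qed.

Lemma flat_area : rho_area D flat_weight <= rho_area D rho.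
Proof.
rewrite !rho_areaE (bigID (in_bar D)) [leRHS](bigID (in_bar D)) /=.
apply: lerD.
  by rewrite !sum_bar_tiles; apply: ler_sum => k _; exact: column_energy.
apply: ler_sum => t /negPf tb; rewrite /flat_weight /flat_upper /flat_lower tb.
by rewrite /lower_level opprB addrC subrK.
Qed.

End FlattenedWeight.

(** * Optimal weight functions *)

Section Optimality.
Context {R : realType} (D : dumbbell R).
Implicit Types (rho sigma : tile -> R) (g : R -> R * R) (t : tile).

Lemma tile_weight_sqr_le sigma t : tiles D t -> sigma t ^+ 2 <= rho_area D sigma.
Proof.
move=> Dt; rewrite rho_areaE (bigD1_seq t) ?tile_seq_uniq //=; last first.
  by rewrite mem_tile_seq; apply/asboolP.
by rewrite lerDl; apply: sumr_ge0 => u _; exact: sqr_ge0.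
Qed.

Lemma rho_area_gt0 sigma : is_weight D sigma -> 0 < rho_area D sigma.
Proof.
move=> [_ [t Dt st]]; apply: lt_le_trans (tile_weight_sqr_le sigma Dt).
by rewrite lt_def sqr_ge0 sqrf_eq0 st.
Qed.

Lemma rho_length_scale_add (a b : R) rho sigma g :
  rho_length D (fun t => a * rho t + b * sigma t) g =
  a * rho_length D rho g + b * rho_length D sigma g.
Proof. by rewrite !rho_lengthE big_split /= !mulr_sumr. Qed.

Lemma fat_flow_modulus_bounded : exists M : R,
  forall sigma, is_weight D sigma -> fat_flow_modulus D sigma <= M.
Proof.
exists ((size (tile_seq D))%:R ^+ 2) => sigma sw; have [s0 _] := sw.
rewrite ler_pdivrMr ?rho_area_gt0 //.
set A := rho_area D sigma; have A0 : 0 <= A by exact/ltW/rho_area_gt0.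
have -> : A = Num.sqrt A ^+ 2 by rewrite sqr_sqrtr.
rewrite -exprMn ler_pXn2r ?nnegrE ?mulr_ge0 ?sqrtr_ge0 ?ler0n //; last first.
  by apply: rho_height_ge => g _; exact: rho_length_ge0.
have [g jg] := joining_path D.
apply: le_trans (rho_height_le s0 jg) _; rewrite rho_lengthE big_mkcond.
have -> : (size (tile_seq D))%:R * Num.sqrt A =
    \sum_(t <- tile_seq D) Num.sqrt A.
  by rewrite big_const_seq count_predT iter_addr_0 mulr_natl.
rewrite big_seq [leRHS]big_seq; apply: ler_sum => t.
rewrite mem_tile_seq => /asboolP Dt; case: ifP => _; last exact: sqrtr_ge0.
rewrite -[sigma t]ger0_norm ?s0 // -sqrtr_sqr ler_wsqrtr //.
exact: tile_weight_sqr_le.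
Qed.

Lemma optimal_modulus_ge rho sigma : fat_flow_optimal D rho ->
  is_weight D sigma -> fat_flow_modulus D sigma <= fat_flow_modulus D rho.
Proof.
move=> [_ ->] sw; apply: ub_le_sup; last by exists sigma.
by have [M HM] := fat_flow_modulus_bounded; exists M => _ [tau /HM + <-].
Qed.

(** The constant weight 1 has positive modulus, because every path touches a tile. *)
Lemma optimal_height_gt0 rho : fat_flow_optimal D rho -> 0 < rho_height D rho.
Proof.
move=> opt; have [[rho0 _] _] := opt.
have h0 : 0 <= rho_height D rho.
  by apply: rho_height_ge => g _; exact: rho_length_ge0.
rewrite lt_def h0 andbT; apply/eqP => H0.
have one0 t : tiles D t -> 0 <= 1 :> R by move=> _; exact: ler01.
have cover p : qdisk D p -> exists2 t, tiles D t & square t p.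
  exact: planar_disk_tile (qdisk_disk D) (dumbbell_subcomplex D).
have w1 : is_weight D (fun=> 1).
  split=> //; have [t Dt _] :=
    cover _ (frontier_sub (top_edge_frontier (top_edge_a D))).
  by exists t => //; exact: oner_neq0.
have := optimal_modulus_ge opt w1.
rewrite /fat_flow_modulus H0 expr0n /= mul0r leNgt divr_gt0 ?rho_area_gt0 //.
rewrite exprn_gt0 // (lt_le_trans ltr01) //.
apply: rho_height_ge => g [_ gD _ _].
have [t Dt tg] : exists2 t, tiles D t & square t (g 0).
  by apply/cover/gD; exists 0 => //=; rewrite in_itv /= lexx ler01.
exact: (rho_length_touched one0 (path_touched0 Dt tg)).
Qed.

(** The modulus of [sigma] has a numerator at least that of [rho], which is positive, and yet is no
    larger; so its denominator is at least as large. *)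
Lemma optimal_area_le rho sigma : fat_flow_optimal D rho ->
    (forall t, tiles D t -> 0 <= sigma t) ->
    (forall g, joins_top_bottom D g -> rho_height D rho <= rho_length D sigma g) ->
  rho_area D rho <= rho_area D sigma.
Proof.
move=> opt s0 sH; have H0 := optimal_height_gt0 opt.
have Hs := rho_height_ge sH.
(* A vanishing [sigma] would give paths of length 0, below the positive height of [rho]. *)
have sw : is_weight D sigma.
  split=> //; apply: contrapT => ns; have [g jg] := joining_path D.
  have := lt_le_trans H0 (sH g jg); rewrite rho_lengthE big1 ?ltxx // => t.
  move=> /asboolP[Dt _]; apply: contrapT => st; apply: ns; exists t => //.
  exact/eqP.
have [rw _] := opt.
have := optimal_modulus_ge opt sw; rewrite /fat_flow_modulus.
rewrite ler_pdivrMr ?rho_area_gt0 // mulrAC ler_pdivlMr ?rho_area_gt0 // => h.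
have : rho_height D rho ^+ 2 * rho_area D rho <=
    rho_height D rho ^+ 2 * rho_area D sigma.
  apply: le_trans h; apply: ler_wpM2r; first exact/ltW/rho_area_gt0.
  by rewrite ler_pXn2r // nnegrE ltW // (lt_le_trans H0).
by rewrite ler_pM2l // exprn_gt0.
Qed.

(** The midpoint [tau] is again admissible, so its area is at least that of [rho]; the parallelogram
    identity then forces the sum of squared differences to vanish. *)
Lemma optimal_unique rho sigma : fat_flow_optimal D rho ->
    (forall t, tiles D t -> 0 <= sigma t) ->
    (forall g, joins_top_bottom D g -> rho_height D rho <= rho_length D sigma g) ->
    rho_area D sigma <= rho_area D rho ->
  forall t, tiles D t -> rho t = sigma t.
Proof.
move=> opt s0 sH area t Dt; have [[r0 _] _] := opt.
pose tau u := 1 / 2 * rho u + 1 / 2 * sigma u.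
have : rho_area D rho <= rho_area D tau.
  apply: (optimal_area_le opt) => [u Du|g jg].
    by have := r0 u Du; have := s0 u Du; rewrite /tau; lra.
  rewrite rho_length_scale_add; have := sH g jg; have := rho_height_le r0 jg; lra.
have : \sum_(u <- tile_seq D) (rho u - sigma u) ^+ 2 =
    2 * rho_area D rho + 2 * rho_area D sigma - 4 * rho_area D tau.
  rewrite !rho_areaE !mulr_sumr -big_split /= -sumrB; apply: eq_bigr => u _.
  by rewrite /tau; field.
move=> E le; have : \sum_(u <- tile_seq D) (rho u - sigma u) ^+ 2 <= 0.
  by rewrite E; lra.
rewrite (bigD1_seq t) ?tile_seq_uniq //=; last first.
  by rewrite mem_tile_seq; apply/asboolP.
have : 0 <= \sum_(u <- tile_seq D | u != t) (rho u - sigma u) ^+ 2.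
  by apply: sumr_ge0 => u _; exact: sqr_ge0.
have := sqr_ge0 (rho t - sigma t) => h1 h2 h3.
have /eqP : (rho t - sigma t) ^+ 2 = 0 by apply/eqP; rewrite eq_le h1 andbT; lra.
by rewrite sqrf_eq0 subr_eq0 => /eqP.
Qed.

End Optimality.

Theorem mainTheorem1 (R : realType) (D : dumbbell R) (rho : tile -> R) :
  fat_flow_optimal D rho ->
  forall t : tile,
    square t `<=` bar D ->
    ((3 * bar_height D)%:R%:E <=
       skinny_path_distance D (square t) (left_ball D `|` right_ball D))%E ->
    rho t = (bar_height D)%:R^-1 * rho_height D rho.
Proof.
move=> opt t /in_barP tb far; have [[r0 _] _] := opt.
have w_ge0 u : tiles D u -> 0 <= flat_weight D rho t u by exact: flat_weight_ge0.
rewrite (optimal_unique opt w_ge0 _ _ (in_bar_tile tb)).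
- exact: flat_weight_t0.
- by move=> g; exact: flat_height.
- exact: flat_area.
Qed.
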